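(* Let $\{(x_k,y_k)\}$ be the sequence generated by the MPGDA-PA algorithm (described in the context) applied to $\min_{x\in\mathcal M}\max_{y\in S}F(x,y)$, $F(x,y)=f(x,y)+h(x)-g(y)$. There is a constant $\bar\alpha>0$, independent of $k$, $i$ and $\varepsilon$, such that for all $k\in\mathbb N$, all $i=0,\dots,T_k-1$ and all $0<\alpha\le\min\{1,\bar\alpha\}$, $$Q_k(R_{x_{k,i}}(\alpha v_{k,i}))\le Q_k(x_{k,i})-\tfrac{\alpha}{4}\beta_{k,i}\|v_{k,i}\|^2+2\rho_k\sigma_y^2,$$ and such that, with $$J_1:=\max\left\{\left\lceil \log_{\eta}\frac{\min\{1,\bar\alpha\}}{4c_1}\right\rceil,0\right\},\qquad S_\rho:=\sum_{k=0}^\infty\rho_k,$$ $$C:=\frac{\sqrt{2\left(\overline Q-\underline Q+\frac{\gamma_0}{2}\sigma_y^2+2(\overline T+1)S_\rho\sigma_y^2\right)l_{\max}}}{\sqrt{3c_1\eta^{J_1}\gamma_0}},$$ for every $\varepsilon>0$ the number $T(\varepsilon):=\min\{k\mid \mathcal G^{\beta_{k,0}}(x_k,y_k)<\varepsilon\}$ satisfies $$T(\varepsilon)\le\frac{\left(\max\{(2\rho_0+\gamma_0)\sigma_y,\,C\}\right)^3}{\varepsilon^3}+1.$$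
   Context: **Setting.** $\mathbb E_1,\mathbb E_2$ are finite-dimensional Euclidean spaces. $\mathcal M\subset\mathbb E_1$ is a compact Riemannian submanifold (embedded submanifold with the metric induced from $\mathbb E_1$), with tangent spaces $T_x\mathcal M$. $S\subset\mathbb E_2$ is a (nonempty) compact convex set, $\sigma_y:=\sup_{y\in S}\|y\|$. $f:\mathbb E_1\times\mathbb E_2\to\mathbb R$ is continuously differentiable and concave in $y$; $h:\mathbb E_1\to\mathbb R$ and $g:\mathbb E_2\to\mathbb R$ are closed convex (possibly nonsmooth). There are constants $L_x,L_y>0$ and $L_h$ with: $\|\nabla_xf(x_1,y)-\nabla_xf(x_2,y)\|\le L_x\|x_1-x_2\|$ for all $x_1,x_2\in\mathcal M$, $y\in S$; $\|\nabla_yf(x_1,y_1)-\nabla_yf(x_2,y_2)\|^2\le L_y^2(\|x_1-x_2\|^2+\|y_1-y_2\|^2)$ for all $(x_1,y_1),(x_2,y_2)\in\mathcal M\times S$; $h$ is $L_h$-Lipschitz. The proximal problems of $h$ on $\mathbb E_1$ and of $g$ on $S$ are assumed exactly solvable. $R$ is a retraction on $\mathcal M$: a smooth map $R:T\mathcal M\to\mathcal M$ whose restrictions $R_x:T_x\mathcal M\to\mathcal M$ satisfy $R_x(0)=x$ and $\mathrm DR_x(0)[v]=v$. **MPGDA-PA algorithm.** Parameters: $c_1\in(0,1)$, $\eta\in(0,1)$, $\gamma_0>0$, $0<l_{\min}<l_{\max}$, a non-increasing positive summable sequence $\{\rho_k\}_{k\ge0}$, $\gamma_k=\gamma_0/k^{1/3}$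 for $k\ge1$ (and $\gamma_0$ for $k=0$), integers $T_k\in[1,\overline T]$ with $\overline T$ a fixed positive integer, starting points $x_0\in\mathcal M$, $y_0\in S$. For each $k$ define $$\Phi_k(x):=\max_{y\in S}\{f(x,y)-g(y)-\tfrac{\gamma_k}{2}\|y\|^2-\tfrac{\rho_k}{2}\|y-y_k\|^2\},\qquad Q_k(x):=h(x)+\Phi_k(x),$$ and let $\overline y_k(x)$ be the unique maximizer in the definition of $\Phi_k(x)$. For $k=0,1,\dots$: set $x_{k,0}=x_k$; for $i=0,\dots,T_k-1$: choose $l_{k,i}\in[l_{\min},l_{\max}]$, set $\beta_{k,i}=l_{k,i}/(\rho_k+\gamma_k)$, compute $$v_{k,i}:=\mathop{\mathrm{argmin}}_{v\in T_{x_{k,i}}\mathcal M}\langle\nabla_xf(x_{k,i},\overline y_k(x_{k,i})),v\rangle+h(x_{k,i}+v)+\tfrac{\beta_{k,i}}{2}\|v\|^2,$$ find the smallest non-negative integer $j$ such that $$Q_k(R_{x_{k,i}}(\eta^jv_{k,i}))\le Q_k(x_{k,i})-c_1\eta^j\beta_{k,i}\|v_{k,i}\|^2+2\rho_k\sigma_y^2,$$ and set $x_{k,i+1}=R_{x_{k,i}}(\eta^jv_{k,i})$. After the inner loop set $x_{k+1}=x_{k,T_k}$, $y_{k+1}=\overline y_k(x_{k+1})$. **Stationarity measure.** For $\beta>0$ and $(x,y)\in\mathcal M\times S$, $$\mathcal G^\beta(x,y):=\max\{\|\beta u\|,\ \mathrm{dist}(0,\nabla_yf(x,y)-\partial g(y)-N_yS)\},$$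 where $u=\mathop{\mathrm{argmin}}_{v\in T_x\mathcal M}\langle\nabla_xf(x,y),v\rangle+h(x+v)+\frac\beta2\|v\|^2$, $\partial g$ is the convex subdifferential and $N_yS$ the normal cone of $S$ at $y$. **Constants.** $\overline Q:=\sup\{F(x,y)\mid x\in\mathcal M,y\in S\}$ and $\underline Q:=\inf\{F(x,y)-\frac{\rho_0}{2}\|y-y_0\|^2-\frac{\gamma_0}{2}\|y\|^2\mid x\in\mathcal M,y\in S\}$. *)

(* Defs.v *)
From HB Require Import structures.
From mathcomp Require Export all_boot all_order all_algebra.
From mathcomp Require Export all_classical all_reals all_analysis.

Set Implicit Arguments.
Unset Strict Implicit.
Unset Printing Implicit Defensive.

Export Order.TTheory GRing.Theory Num.Theory.
Export numFieldNormedType.Exports.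

Global Open Scope classical_set_scope.
Global Open Scope ring_scope.

(* MathComp-Analysis. A Euclidean space is 'rV[R]_n with the dot product. Its
   library norm `|_| is the sup norm: it is used only through the topology and
   the (norm independent) differential calculus; every norm of the mathematics
   is enorm. *)
Section Euclidean.
Context {R : realType} {n : nat}.
Implicit Types (u v x y p : 'rV[R]_n) (S : set 'rV[R]_n).

Definition dot u v : R := \sum_(i < n) u 0 i * v 0 i.

Definition enorm u : R := Num.sqrt (dot u u).

Definition gradient (F : 'rV[R]_n -> R) x : 'rV[R]_n :=
  \row_(j < n) 'D_(delta_mx 0 j) (F : 'rV[R]_n -> R^o) x.

Definition dist0 S : R := inf [set enorm w | w in S].

Definition subdifferential (g : 'rV[R]_n -> R) y : set 'rV[R]_n :=
  [set p | forall z, g y + dot p (z - y) <= g z].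

Definition normal_cone S y : set 'rV[R]_n :=
  [set p | forall z, S z -> dot p (z - y) <= 0].

Definition closed_convex (g : 'rV[R]_n -> R) : Prop :=
  closed [set p : 'rV[R]_n * R | g p.1 <= p.2] /\
  convex_function [set: 'rV[R]_n] g.

Definition is_argmin S (F : 'rV[R]_n -> R) : set 'rV[R]_n :=
  [set v | S v /\ forall w, S w -> F v <= F w].

Definition is_argmax S (F : 'rV[R]_n -> R) : set 'rV[R]_n :=
  [set v | S v /\ forall w, S w -> F w <= F v].

(* Only used where the minimizer (resp. maximizer) exists and is unique. *)
Definition argmin S F : 'rV[R]_n := xget 0 (is_argmin S F).
Definition argmax S F : 'rV[R]_n := xget 0 (is_argmax S F).

End Euclidean.

(* In finite dimension this is the usual class C^k on the open set U. *)
Fixpoint Ck_on {R : realType} {V W : normedModType R} (k : nat) (U : set V)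
    (F : V -> W) : Prop :=
  if k is k'.+1 then
    (forall x, U x -> differentiable F x) /\
    (forall v, Ck_on k' U (fun x => 'D_v F x))
  else forall x, U x -> {for x, continuous F}.

Definition smooth_on {R : realType} {V W : normedModType R} (U : set V)
    (F : V -> W) : Prop := forall k, Ck_on k U F.

Section Manifold.
Context {R : realType} {n : nat}.
Variable M : set 'rV[R]_n.

Definition local_defining_map (x : 'rV[R]_n) (m : nat) (U : set 'rV[R]_n)
    (phi : 'rV[R]_n -> 'rV[R]_m) : Prop :=
  [/\ open U, U x, smooth_on U phi,
      forall z, U z -> (M z <-> phi z = 0)
    & forall z, U z -> \rank ('J phi z) = m].

(* m is the codimension. *)
Definition embedded_submanifold : Prop :=
  exists m : nat, forall x, M x ->
    exists (U : set 'rV[R]_n) (phi : 'rV[R]_n -> 'rV[R]_m),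
      local_defining_map x U phi.

(* T_x M is the kernel of the differential at x of a local defining map; for an
   embedded submanifold this kernel does not depend on the map. *)
Definition tangent_space (x : 'rV[R]_n) : set 'rV[R]_n :=
  [set v | forall m (U : set 'rV[R]_n) (phi : 'rV[R]_n -> 'rV[R]_m),
     local_defining_map x U phi -> 'd phi x v = 0].

Definition tangent_bundle : set ('rV[R]_n * 'rV[R]_n) :=
  [set p | M p.1 /\ tangent_space p.1 p.2].

(* retr x v stands for R_x(v); its values off the tangent bundle are junk.
   Smoothness of a map on the tangent bundle, an embedded submanifold of
   'rV_n * 'rV_n, means that it locally extends to a smooth map. *)
Definition retraction (retr : 'rV[R]_n -> 'rV[R]_n -> 'rV[R]_n) : Prop :=
  [/\ forall p, tangent_bundle p -> M (retr p.1 p.2),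
      forall p, tangent_bundle p ->
        exists (U : set ('rV[R]_n * 'rV[R]_n))
               (F : 'rV[R]_n * 'rV[R]_n -> 'rV[R]_n),
          [/\ open U, U p, smooth_on U F
            & forall q, U q -> tangent_bundle q -> retr q.1 q.2 = F q],
      forall x, M x -> retr x 0 = x
    & forall x v, M x -> tangent_space x v ->
        is_derive (0 : R) (1 : R) (fun t : R => retr x (t *: v)) v].

End Manifold.

Section Minimax.
Context {R : realType} {n1 n2 : nat}.
Variables (M : set 'rV[R]_n1) (S : set 'rV[R]_n2).
Variables (f : 'rV[R]_n1 -> 'rV[R]_n2 -> R).
Variables (h : 'rV[R]_n1 -> R) (g : 'rV[R]_n2 -> R).

Definition objective x y : R := f x y + h x - g y.

Definition grad_x x y : 'rV[R]_n1 := gradient (f^~ y) x.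
Definition grad_y x y : 'rV[R]_n2 := gradient (f x) y.

Definition sigma_y : R := sup [set enorm y | y in S].

Definition minimax_problem (Lx Ly Lh : R) : Prop :=
  [/\ [/\ compact M, embedded_submanifold M, compact S, S !=set0
        & convex_set (M := 'rV[R]_n2) S],
      Ck_on 1 [set: 'rV[R]_n1 * 'rV[R]_n2]
        (fun p => f p.1 p.2 : R^o) /\
      (forall x, convex_function [set: 'rV[R]_n2] (fun y => - f x y)),
      closed_convex h /\ closed_convex g,
      [/\ 0 < Lx, 0 < Ly,
          forall x1 x2 y, M x1 -> M x2 -> S y ->
            enorm (grad_x x1 y - grad_x x2 y) <= Lx * enorm (x1 - x2)
        & forall x1 x2 y1 y2, M x1 -> M x2 -> S y1 -> S y2 ->
            enorm (grad_y x1 y1 - grad_y x2 y2) ^+ 2 <=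
            Ly ^+ 2 * (enorm (x1 - x2) ^+ 2 + enorm (y1 - y2) ^+ 2)]
    & forall x1 x2, `|h x1 - h x2| <= Lh * enorm (x1 - x2)].

(* Objective of the proximal-linear subproblem in v, where y is the current
   dual point. *)
Definition prox_linear (b : R) x y (v : 'rV[R]_n1) : R :=
  dot (grad_x x y) v + h (x + v) + b / 2 * enorm v ^+ 2.

Definition stationarity (b : R) x y : R :=
  Num.max
    (enorm (b *: argmin (tangent_space M x) (prox_linear b x y)))
    (dist0 [set w | exists p q, [/\ subdifferential g y p, normal_cone S y q
                                  & w = grad_y x y - p - q]]).

(* gam, r and yc stand for gamma_k, rho_k and y_k. *)
Definition regularized (gam r : R) (yc : 'rV[R]_n2) x y : R :=
  f x y - g y - gam / 2 * enorm y ^+ 2 - r / 2 * enorm (y - yc) ^+ 2.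

(* The supremum is attained since S is compact. *)
Definition Phi gam r yc x : R := sup [set regularized gam r yc x y | y in S].

Definition Q gam r yc x : R := h x + Phi gam r yc x.

Definition ybar gam r yc x : 'rV[R]_n2 := argmax S (regularized gam r yc x).

Definition Q_upper : R :=
  sup [set objective p.1 p.2 | p in M `*` S].

Definition Q_lower (gamma0 rho0 : R) (y0 : 'rV[R]_n2) : R :=
  inf [set objective p.1 p.2 - rho0 / 2 * enorm (p.2 - y0) ^+ 2
           - gamma0 / 2 * enorm p.2 ^+ 2 | p in M `*` S].

End Minimax.

Section Algorithm.
Context {R : realType} {n1 n2 : nat}.
Variables (M : set 'rV[R]_n1) (S : set 'rV[R]_n2).
Variables (f : 'rV[R]_n1 -> 'rV[R]_n2 -> R).
Variables (h : 'rV[R]_n1 -> R) (g : 'rV[R]_n2 -> R).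
Variable (retr : 'rV[R]_n1 -> 'rV[R]_n1 -> 'rV[R]_n1).
Variables (c1 eta gamma0 lmin lmax : R) (rho : nat -> R).
Variables (Tbar : nat) (T : nat -> nat).

Definition gamma (k : nat) : R :=
  if k == 0%N then gamma0 else gamma0 / k%:R `^ (3%:R^-1).

Definition beta (l : nat -> nat -> R) (k i : nat) : R :=
  l k i / (rho k + gamma k).

Definition mpgda_pa_params : Prop :=
  [/\ 0 < c1 < 1, 0 < eta < 1, 0 < gamma0 & 0 < lmin < lmax] /\
  [/\ forall k, 0 < rho k,
      nonincreasing_seq rho,
      cvgn (series rho)
    & forall k, (1 <= T k <= Tbar)%N].

Variables (y : nat -> 'rV[R]_n2).

Definition Qk (k : nat) := Q S f h g (gamma k) (rho k) (y k).
Definition ybark (k : nat) := ybar S f g (gamma k) (rho k) (y k).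

(* x k = x_k, y k = y_k, xi k i = x_{k,i} for 0 <= i <= T_k, and l k i, v k i,
   j k i are l_{k,i}, v_{k,i} and the line-search exponent for i < T_k; the
   other entries of the doubly indexed sequences are junk. *)
Definition mpgda_pa_run (x0 : 'rV[R]_n1) (y0 : 'rV[R]_n2)
    (x : nat -> 'rV[R]_n1) (xi : nat -> nat -> 'rV[R]_n1)
    (l : nat -> nat -> R) (v : nat -> nat -> 'rV[R]_n1)
    (j : nat -> nat -> nat) : Prop :=
  let b := beta l in
  let accept k i (t : nat) :=
    Qk k (retr (xi k i) (eta ^+ t *: v k i)) <=
    Qk k (xi k i) - c1 * eta ^+ t * b k i * enorm (v k i) ^+ 2
    + 2 * rho k * sigma_y S ^+ 2 in
  [/\ M x0 /\ S y0,
      x 0%N = x0 /\ y 0%N = y0,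
      forall k, xi k 0%N = x k,
      forall k i, (i < T k)%N ->
        [/\ lmin <= l k i <= lmax,
            is_argmin (tangent_space M (xi k i))
              (prox_linear f h (b k i) (xi k i) (ybark k (xi k i))) (v k i),
            accept k i (j k i),
            forall t, (t < j k i)%N -> ~ accept k i t
          & xi k i.+1 = retr (xi k i) (eta ^+ j k i *: v k i)]
    & forall k, x k.+1 = xi k (T k) /\ y k.+1 = ybark k (x k.+1)].

Definition J1 (abar : R) : int :=
  Num.max (Num.ceil (ln (Num.min 1 abar / (4 * c1)) / ln eta)) 0.

Definition complexity_constant (abar : R) (y0 : 'rV[R]_n2) : R :=
  Num.sqrt (2 * (Q_upper M S f h g - Q_lower M S f h g gamma0 (rho 0%N) y0
                 + gamma0 / 2 * sigma_y S ^+ 2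
                 + 2 * (Tbar.+1)%:R * limn (series rho) * sigma_y S ^+ 2)
            * lmax)
  / Num.sqrt (3 * c1 * eta ^ J1 abar * gamma0).

End Algorithm.

(* Main.v *)
From HB Require Import structures.
Require Import Defs.
From mathcomp Require Import ring lra.

(* With mu = rho_k + gamma_k, strong concavity of the dual problem and the
   Lipschitz bound on the y-gradient give, without differentiating Phi_k,
     Phi_k(x') - Phi_k(x) <= f(x', y) - f(x, y) + Ly^2 |x' - x|^2 / (2 mu)
   for x, x' in M and y = ybar_k(x). As beta_k is of order 1 / mu, a step
   a v with a below a constant therefore decreases Q_k by c a beta_k |v|^2, for
   any fixed c < 1. So the line search exponents are bounded and
   sum_k beta_k |v_{k,0}|^2 is finite.

   The measure at (x_k, y_k) uses the gradient at y_k = ybar_{k-1}(x_k), while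
   v_{k,0} uses ybar_k(x_k). Only the tangential part of the x-gradient matters
   for the prox step, and this part is Ly-Lipschitz in y (symmetry of the mixed
   second differences of f); moreover |y_k - ybar_k(x_k)| = O(k^(-2/3)), because
   gamma_{k-1} - gamma_k = O(k^(-4/3)) and k rho_k <= sum rho. Hence the measure
   is at most beta_k |v_{k,0}| + O(k^(-1/3)), and summing over a window
   [K, 2K) gives T(eps) <= B / eps^3 + 2 for some B.

   This B need not be bounded by the constants of the problem alone. But C tends
   to infinity as abar tends to 0, because of the factor eta^J1, and the descent
   inequality persists for smaller abar: it suffices to take abar small. The
   exception is a vanishing numerator in C, in which case S = {0}, F(., 0) is
   constant on M, and the starting point is already stationary. *)

Set Implicit Arguments.
Unset Strict Implicit.
Unset Printing Implicit Defensive.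

(** * Euclidean norm *)

Section EuclideanNorm.
Context {R : realType} {n : nat}.
Implicit Types (u v w : 'rV[R]_n) (a : R).

Lemma dotC u v : dot u v = dot v u.
Proof. by apply: eq_bigr => i _; rewrite mulrC. Qed.

Lemma dotDl u v w : dot (u + v) w = dot u w + dot v w.
Proof. by rewrite -big_split; apply: eq_bigr => i _; rewrite mxE mulrDl. Qed.

Lemma dotDr u v w : dot u (v + w) = dot u v + dot u w.
Proof. by rewrite dotC dotDl !(dotC u). Qed.

Lemma dotZl a u v : dot (a *: u) v = a * dot u v.
Proof. by rewrite /dot mulr_sumr; apply: eq_bigr => i _; rewrite mxE mulrA. Qed.

Lemma dotZr a u v : dot u (a *: v) = a * dot u v.
Proof. by rewrite dotC dotZl dotC. Qed.

Lemma dotNl u v : dot (- u) v = - dot u v.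
Proof. by rewrite -scaleN1r dotZl mulN1r. Qed.

Lemma dotNr u v : dot u (- v) = - dot u v.
Proof. by rewrite dotC dotNl dotC. Qed.

Lemma dotBl u v w : dot (u - v) w = dot u w - dot v w.
Proof. by rewrite dotDl dotNl. Qed.

Lemma dotBr u v w : dot u (v - w) = dot u v - dot u w.
Proof. by rewrite dotDr dotNr. Qed.

Lemma dot0l u : dot 0 u = 0.
Proof. by rewrite -(scale0r u) dotZl mul0r. Qed.

Lemma dot0r u : dot u 0 = 0.
Proof. by rewrite dotC dot0l. Qed.

Lemma dot_delta u i : dot u (delta_mx 0 i) = u 0 i.
Proof.
rewrite /dot (bigD1 i)//= mxE !eqxx mulr1 big1 ?addr0// => j ji.
by rewrite mxE (negbTE ji) andbF mulr0.
Qed.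

Lemma dot_ge0 u : 0 <= dot u u.
Proof. by apply: sumr_ge0 => i _; rewrite -expr2 sqr_ge0. Qed.

Lemma enorm_ge0 u : 0 <= enorm u. Proof. exact: sqrtr_ge0. Qed.

Lemma enorm_sqr u : enorm u ^+ 2 = dot u u.
Proof. by rewrite sqr_sqrtr ?dot_ge0. Qed.

Lemma enorm_sqrD u v : enorm (u + v) ^+ 2 =
  enorm u ^+ 2 + 2 * dot u v + enorm v ^+ 2.
Proof. rewrite !enorm_sqr dotDl !dotDr (dotC v u); ring. Qed.

Lemma enorm_sqrB u v : enorm (u - v) ^+ 2 =
  enorm u ^+ 2 - 2 * dot u v + enorm v ^+ 2.
Proof. rewrite !enorm_sqr dotBl !dotBr (dotC v u); ring. Qed.

Lemma enormZ a u : enorm (a *: u) = `|a| * enorm u.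
Proof.
by rewrite /enorm dotZl dotZr mulrA -expr2 sqrtrM ?sqr_ge0// sqrtr_sqr.
Qed.

Lemma enormZp a u : 0 <= a -> enorm (a *: u) = a * enorm u.
Proof. by move=> a0; rewrite enormZ ger0_norm. Qed.

Lemma enormN u : enorm (- u) = enorm u.
Proof. by rewrite -scaleN1r enormZ normrN1 mul1r. Qed.

Lemma enormBC u v : enorm (u - v) = enorm (v - u).
Proof. by rewrite -enormN opprB. Qed.

Lemma enorm0 : enorm (0 : 'rV[R]_n) = 0.
Proof. by rewrite /enorm dot0l sqrtr0. Qed.

Lemma cauchy_schwarz u v : dot u v <= enorm u * enorm v.
Proof.
have [u0|u0] := eqVneq (enorm u) 0.
  rewrite u0 mul0r; have uu := enorm_sqr u; rewrite u0 expr0n /= in uu.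
  have : forall i, u 0 i = 0.
    move=> i; apply/eqP; rewrite -sqrf_eq0 expr2; apply/eqP.
    have /psumr_eq0P : \sum_(i < n) u 0 i * u 0 i = 0 by [].
    by apply=> // k _; rewrite -expr2 sqr_ge0.
  by move=> ui; rewrite /dot big1// => i _; rewrite ui mul0r.
have [v0|v0] := eqVneq (enorm v) 0.
  rewrite v0 mulr0; have vv := enorm_sqr v; rewrite v0 expr0n /= in vv.
  have : forall i, v 0 i = 0.
    move=> i; apply/eqP; rewrite -sqrf_eq0 expr2; apply/eqP.
    have /psumr_eq0P : \sum_(i < n) v 0 i * v 0 i = 0 by [].
    by apply=> // k _; rewrite -expr2 sqr_ge0.
  by move=> vi; rewrite /dot big1// => i _; rewrite vi mulr0.
have up : 0 < enorm u by rewrite lt_neqAle eq_sym u0 enorm_ge0.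
have vp : 0 < enorm v by rewrite lt_neqAle eq_sym v0 enorm_ge0.
(* The square expands to 2|u||v|(|u||v| - <u,v>), and the first factor is positive. *)
have := sqr_ge0 (enorm (enorm v *: u - enorm u *: v)).
rewrite enorm_sqrB !enormZp ?enorm_ge0// dotZl dotZr => H.
have {}H : 0 <= (2 * (enorm u * enorm v)) * (enorm u * enorm v - dot u v).
  by apply: (le_trans H); rewrite le_eqVlt; apply/orP; left; apply/eqP; ring.
by move: H; rewrite pmulr_rge0 ?subr_ge0// ?mulr_gt0.
Qed.

Lemma enormD u v : enorm (u + v) <= enorm u + enorm v.
Proof.
rewrite -ler_sqr ?nnegrE ?addr_ge0 ?enorm_ge0// enorm_sqrD sqrrD.
by have := cauchy_schwarz u v; lra.
Qed.

Lemma enormB u v : enorm (u - v) <= enorm u + enorm v.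
Proof. by rewrite -(enormN v) enormD. Qed.

Lemma coord_le_enorm u i : `|u 0 i| <= enorm u.
Proof.
rewrite -ler_sqr ?nnegrE ?normr_ge0 ?enorm_ge0// enorm_sqr real_normK ?num_real//.
rewrite /dot (bigD1 i)//= -expr2 lerDl.
by apply: sumr_ge0 => k _; rewrite -expr2 sqr_ge0.
Qed.

Lemma coord_le_norm u i : `|u 0 i| <= `|u|.
Proof.
rewrite [leRHS]/Num.norm/= mx_normE.
exact: (le_bigmax _ (fun ij : 'I_1 * 'I_n => `|u ij.1 ij.2|%:nng) (0, i)).
Qed.

Lemma norm_le_coord u a : 0 <= a -> (forall i, `|u 0 i| <= a) -> `|u| <= a.
Proof.
move=> a0 ua; rewrite [leLHS]/Num.norm/= mx_normE -[a]/((NngNum a0)%:num).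
by rewrite num_le; apply: bigmax_le => [|[i k] _]; rewrite -num_le//= (ord1 i).
Qed.

Lemma norm_le_enorm u : `|u| <= enorm u.
Proof. by apply: norm_le_coord; rewrite ?enorm_ge0// => i; exact: coord_le_enorm. Qed.

Lemma enorm_le_coord u a : 0 <= a -> (forall i, `|u 0 i| <= a) ->
  enorm u <= n%:R * a.
Proof.
move=> a0 ua; rewrite -ler_sqr ?nnegrE ?enorm_ge0 ?mulr_ge0// enorm_sqr.
have : dot u u <= n%:R * a ^+ 2.
  rewrite -[n in n%:R]card_ord -sum1_card natr_sum mulr_suml.
  apply: ler_sum => i _.
  rewrite mul1r -expr2 -real_normK ?num_real// ler_sqr ?nnegrE//.
move/le_trans; apply; rewrite exprMn ler_wpM2r ?sqr_ge0//.
by rewrite -natrX ler_nat; case: (n) => // m; rewrite expnS expn1 leq_pmulr.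
Qed.

Lemma enorm_le_norm u : enorm u <= n%:R * `|u|.
Proof. by apply: enorm_le_coord => // i; exact: coord_le_norm. Qed.

End EuclideanNorm.

(** * Convex functions *)

(** Replaces the passage to the limit t -> 0 in the convexity and derivative arguments below. *)
Lemma ler_of_small {R : realType} (a b c : R) :
  (forall t, 0 < t <= 1 -> a <= b + t * c) -> a <= b.
Proof.
move=> H; rewrite leNgt; apply/negP => ba.
(* If a > b, this [d] solves d (|c| + (a - b)) = a - b, so t = d / 2 makes t c smaller than a -
   b. *)
pose d := (a - b) / (`|c| + (a - b)).
have D0 : 0 < `|c| + (a - b) by rewrite ltr_wpDl ?subr_gt0.
have d0 : 0 < d by rewrite divr_gt0 ?subr_gt0.
have d1 : d <= 1 by rewrite ler_pdivrMr// mul1r lerDr.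
have := H (d / 2); have -> : 0 < d / 2 <= 1 by apply/andP; split; lra.
move=> /(_ isT) {}H.
have : d * (`|c| + (a - b)) = a - b by rewrite mulfVK ?gt_eqF.
have : d * c <= d * `|c| by rewrite ler_pM2l// ler_norm.
have : 0 < d * (a - b) by rewrite mulr_gt0 ?subr_gt0.
lra.
Qed.

Section Convexity.
Context {R : realType} {n : nat}.
Implicit Types (F g : 'rV[R]_n -> R) (S : set 'rV[R]_n).

(** Convexity with a plain real weight instead of the bundled interval weight of
    [convex_function]. *)
Definition cvx F := forall a b t, 0 <= t <= 1 ->
  F (t *: a + (1 - t) *: b) <= t * F a + (1 - t) * F b.

Definition cvxset S := forall a b t, S a -> S b -> 0 <= t <= 1 ->
  S (t *: a + (1 - t) *: b).

Lemma convex_function_cvx F : convex_function [set: 'rV[R]_n] F -> cvx F.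
Proof.
move=> cF a b t /andP[t0 t1].
by apply: (cF (Itv01 t0 t1) a b); rewrite inE.
Qed.

Lemma convex_set_cvxset S : convex_set (M := 'rV[R]_n) S -> cvxset S.
Proof.
move=> cS a b t Sa Sb /andP[t0 t1]; apply/set_mem.
by apply: (cS a b (Itv01 t0 t1)); rewrite inE.
Qed.

Lemma cvx_mid F a b : cvx F -> 2 * F (2^-1 *: (a + b)) <= F a + F b.
Proof.
move=> /(_ a b 2^-1); have -> : 0 <= (2^-1 : R) <= 1 by apply/andP; split; lra.
have -> : 1 - 2^-1 = 2^-1 :> R by lra.
by rewrite -scalerDr => /(_ isT); lra.
Qed.

(** The span of the first k coordinate vectors; the two inductions below enlarge it by one
    coordinate at a time. *)
Let coords_below (k : nat) (d : 'rV[R]_n) :=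
  forall i : 'I_n, (k <= i)%N -> d 0 i = 0.

Lemma coords_belowP k (kn : (k < n)%N) d : coords_below k.+1 d ->
  coords_below k (d - d 0 (Ordinal kn) *: delta_mx 0 (Ordinal kn)).
Proof.
move=> dk i; rewrite !mxE eqxx /=; case: eqVneq => [->|ni] ki.
  by rewrite mulr1 subrr.
rewrite mulr0 subr0 dk// ltn_neqAle ki andbT.
by apply: contra ni => /eqP ki'; apply/eqP/val_inj.
Qed.

(* Hahn-Banach, extending the functional one coordinate at a time. *)
Lemma cvx_linear_minorant F : cvx F -> 0 <= F 0 ->
  exists s, forall d, dot s d <= F d.
Proof.
move=> cF F0.
suff /(_ n (leqnn n))[s Hs] : forall k, (k <= n)%N ->
    exists s, forall d, coords_below k d -> dot s d <= F d.
  by exists s => d; apply: Hs => i; rewrite leqNgt ltn_ord.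
elim=> [_|k IH kn].
  exists 0 => d d0; rewrite dot0l (_ : d = 0)//.
  by apply/rowP => i; rewrite mxE d0.
have [s Hs] := IH (ltnW kn).
pose e : 'rV[R]_n := delta_mx 0 (Ordinal kn).
(* The slope along [e] has to lie between the backward quotients collected in [A] and the forward
   quotients of [AB]. *)
pose A := [set a | exists d t, [/\ coords_below k d, 0 < t
                                 & a = (dot s d - F (d - t *: e)) / t]].
(* The convex combination with weights t/(t+r) and r/(t+r) cancels the two [e] components and lands
   where [s] is already a minorant. *)
have AB d t : coords_below k d -> 0 < t ->
    ubound A ((F (d + t *: e) - dot s d) / t).
  move=> dk t0 _ [d' [r [d'k r0 ->]]].
  rewrite ler_pdivrMr// mulrAC ler_pdivlMr//.
  have tr0 : 0 < t + r by rewrite addr_gt0.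
  have tr1 : 0 <= t / (t + r) <= 1.
    by rewrite divr_ge0 ?(ltW t0, ltW tr0)//= ler_pdivrMr// mul1r lerDl ltW.
  have := cF (d' - r *: e) (d + t *: e) _ tr1.
  have -> : 1 - t / (t + r) = r / (t + r).
    by rewrite -[1](@divff _ (t + r)) ?gt_eqF// -mulrBl addrC addKr.
  have -> : (t / (t + r)) *: (d' - r *: e) + (r / (t + r)) *: (d + t *: e) =
      (t / (t + r)) *: d' + (r / (t + r)) *: d.
    apply/rowP => i; rewrite !mxE; field; lra.
  have /Hs : coords_below k ((t / (t + r)) *: d' + (r / (t + r)) *: d).
    by move=> i ki; rewrite !mxE dk// d'k// !mulr0 addr0.
  rewrite dotDr !dotZr => H1 H2; have {H2}H1 := le_trans H1 H2.
  have {}H1 := ler_wpM2r (ltW tr0) H1.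
  rewrite !mulrDl in H1.
  have E z w : z / (t + r) * w * (t + r) = z * w by field; lra.
  by rewrite !E in H1; lra.
have cb0 : coords_below k 0 by move=> i _; rewrite mxE.
have A0 : has_sup A.
  split; first by exists ((dot s 0 - F (0 - 1 *: e)) / 1), 0, 1.
  by eexists; exact: (AB 0 1 cb0 ltr01).
(* The old [s] may have a nonzero coordinate at this index; subtracting it makes the new slope along
   [e] exactly [sup A]. *)
pose a := sup A - s 0 (Ordinal kn).
exists (s + a *: e) => d dk; set t := d 0 (Ordinal kn).
have [d' [d'k dE]] : exists d', coords_below k d' /\ d = d' + t *: e.
  by exists (d - t *: e); rewrite subrK; split=> //; exact: coords_belowP.
have -> : dot (s + a *: e) d = dot s d' + sup A * t.
  rewrite dotDl dotZl (dotC e) dot_delta -/t dE dotDr dotZr dot_delta /a; ring.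
have [t0|t0|t0] := ltgtP t 0.
- have : (dot s d' - F d) / (- t) <= sup A.
    apply: (@ub_le_sup _ A); first by case: A0.
    exists d', (- t); split=> //; first by rewrite oppr_gt0.
    by rewrite dE scaleNr opprK.
  rewrite ler_pdivrMr ?oppr_gt0//; lra.
- have : sup A <= (F d - dot s d') / t.
    by apply: ge_sup; [case: A0|rewrite dE; exact: AB].
  rewrite ler_pdivlMr//; lra.
- by rewrite dE t0 mulr0 scale0r !addr0 Hs.
Qed.

(** The optimality condition is split between g and S by a linear minorant [s] of the value function
    [P] of the problem with the argument of g shifted by d. Testing [P] at z - y with w = y gives
    the subgradient inequality, and at y - z with w = z the normal cone inequality. *)
Lemma subdifferential_sum_rule S g y p : cvxset S -> cvx g -> S y ->
  (forall z, S z -> g y - dot p y <= g z - dot p z) ->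
  exists s, subdifferential g y s /\ normal_cone S y (p - s).
Proof.
move=> cS cg Sy ymin.
pose V d := [set g (w + d) - dot p w | w in S].
pose c := g y - dot p y.
pose P d := inf (V d) - c.
(* The infimum is finite: the midpoint of w + d and y - d is the midpoint of w and y, which lies in
   S, where [ymin] applies. *)
have lbV d : lbound (V d) (2 * c + dot p y - g (y - d)).
  move=> _ [w Sw <-].
  have := cvx_mid (w + d) (y - d) cg.
  have -> : 2^-1 *: (w + d + (y - d)) = 2^-1 *: w + (1 - 2^-1) *: y.
    apply/rowP => i; rewrite !mxE; lra.
  have /(cS _ _ _ Sw Sy)/ymin : 0 <= (2^-1 : R) <= 1 by apply/andP; split; lra.
  rewrite dotDr !dotZr /c; lra.
have infV d : has_inf (V d).
  by split; [exists (g (y + d) - dot p y), y|eexists; exact: lbV].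
have PleV d w : S w -> P d <= g (w + d) - dot p w - c.
  move=> Sw; rewrite lerD2r; apply: (@ge_inf _ (V d)); last by exists w.
  by case: (infV d).
have cP : cvx P.
  move=> a b t /andP[t0 t1].
  suff : forall e, 0 < e -> P (t *: a + (1 - t) *: b) <=
      t * P a + (1 - t) * P b + e by move=> H; apply/ler_addgt0Pr.
  move=> e e0.
  have [_ [w1 Sw1 <-] H1] := inf_adherent e0 (infV a).
  have [_ [w2 Sw2 <-] H2] := inf_adherent e0 (infV b).
  have t01 : 0 <= t <= 1 by rewrite t0.
  have := PleV (t *: a + (1 - t) *: b) _ (cS _ _ _ Sw1 Sw2 t01).
  have := cg (w1 + a) (w2 + b) _ t01.
  have -> : t *: (w1 + a) + (1 - t) *: (w2 + b) =
     t *: w1 + (1 - t) *: w2 + (t *: a + (1 - t) *: b).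
    by rewrite !scalerDr addrACA.
  rewrite dotDr !dotZr /P.
  have := ler_wpM2l t0 (ltW H1).
  have /ler_wpM2l/(_ _ _ (ltW H2)) : 0 <= 1 - t by rewrite subr_ge0.
  lra.
have P0 : 0 <= P 0.
  rewrite subr_ge0; apply: lb_le_inf; first by case: (infV 0).
  by move=> _ [w Sw <-]; rewrite addr0 ymin.
have [s Hs] := cvx_linear_minorant cP P0.
exists s; split => z.
  have := le_trans (Hs _) (PleV (z - y) y Sy).
  rewrite [y + _]addrC subrK /c; lra.
move=> Sz; have := le_trans (Hs _) (PleV (y - z) z Sz).
rewrite [z + _]addrC subrK dotBl !dotBr /c; lra.
Qed.

(** Induction on the number of active coordinates: y is the midpoint of 2(y - t e), which has one
    coordinate fewer, and 2 t e, which lies between -2B e and 2B e. This is why the box doubles at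
    each step. *)
Lemma cvx_ub_box F : cvx F -> forall B : R, exists c, forall y : 'rV[R]_n,
  (forall i, `|y 0 i| <= B) -> F y <= c.
Proof.
move=> cF.
suff H k : (k <= n)%N -> forall B : R, exists c, forall y : 'rV[R]_n, coords_below k y ->
    (forall i, `|y 0 i| <= B) -> F y <= c.
  move=> B; have [c Hc] := H n (leqnn n) B; exists c => y; apply: Hc => i.
  by rewrite leqNgt ltn_ord.
elim: k => [_ B|k IH kn B].
  exists (F 0) => y y0 _; rewrite (_ : y = 0)//.
  by apply/rowP => i; rewrite mxE y0.
have [c Hc] := IH (ltnW kn) (2 * B).
pose e : 'rV[R]_n := delta_mx 0 (Ordinal kn).
pose m := Num.max (F ((2 * B) *: e)) (F (- (2 * B) *: e)).
exists ((c + m) / 2) => y yk yB; set t := y 0 (Ordinal kn).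
have y'k := coords_belowP kn yk; rewrite -/t -/e in y'k.
have := cvx_mid (2 *: (y - t *: e)) (2 *: (t *: e)) cF.
rewrite -scalerDr scalerA mulVf// scale1r subrK.
have : F (2 *: (y - t *: e)) <= c.
  apply: Hc => i; first by move=> ki; rewrite mxE y'k// mulr0.
  rewrite mxE normrM ger0_norm// ler_pM2l//.
  rewrite !mxE eqxx /=; case: eqVneq => [->|ni].
    by rewrite mulr1 subrr normr0 (le_trans _ (yB i)).
  by rewrite mulr0 subr0.
have : F (2 *: (t *: e)) <= m.
  have tB : `|t| <= B := yB _.
  have [B0|B0] := eqVneq B 0.
    have -> : t = 0 by apply/eqP; rewrite -normr_le0 -B0.
    by rewrite /m B0 mulr0 oppr0 !scale0r scaler0 maxxx.
  have Bp : 0 < B by rewrite lt_neqAle eq_sym B0 (le_trans _ tB).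
  have r01 : 0 <= (t / B + 1) / 2 <= 1.
    have : -1 <= t / B <= 1.
      by rewrite ler_pdivlMr// ler_pdivrMr// mulN1r mul1r -ler_norml.
    by move=> /andP[? ?]; apply/andP; split; lra.
  have := cF ((2 * B) *: e) (- (2 * B) *: e) _ r01.
  have -> : (t / B + 1) / 2 *: (2 * B *: e) + (1 - (t / B + 1) / 2) *: (- (2 * B) *: e)
      = 2 *: (t *: e).
    rewrite !scalerA -scalerDl; congr (_ *: _); field; lra.
  move/le_trans; apply.
  have /andP[r0 r1] := r01.
  have /(ler_wpM2l r0) : F (2 * B *: e) <= m by rewrite le_max lexx.
  have /ler_wpM2l : 0 <= 1 - (t / B + 1) / 2 by lra.
  move=> /(_ (F (- (2 * B) *: e)) m); rewrite le_max lexx orbT => /(_ isT); lra.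
lra.
Qed.

(** The box gives the upper bound; the lower one follows from 2 F(0) <= F(y) + F(-y). *)
Lemma cvx_bounded F : cvx F -> forall r, exists c, forall y : 'rV[R]_n,
  enorm y <= r -> `|F y| <= c.
Proof.
move=> cF r; have [c Hc] := cvx_ub_box cF r.
have H y : enorm y <= r -> F y <= c.
  by move=> yr; apply: Hc => i; exact: le_trans (coord_le_enorm _ _) yr.
exists (`|c| + 2 * `|F 0|) => y yr.
have := cvx_mid y (- y) cF; rewrite subrr scaler0.
have := H (- y); rewrite enormN => /(_ yr); have := H y yr.
have := ler_norm c; have := ler_norm (- F 0); rewrite normrN.
rewrite ler_norml; have := normr_ge0 (F 0); lra.
Qed.

(** Quadratic growth at a minimizer: compare the two hypotheses on the segment, divide by t and let
    t tend to 0. *)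
Lemma strong_convex_min F a b m :
  (forall t, 0 < t <= 1 -> F ((1 - t) *: a + t *: b) <=
      (1 - t) * F a + t * F b - m / 2 * (t * (1 - t)) * enorm (b - a) ^+ 2) ->
  (forall t, 0 < t <= 1 -> F a <= F ((1 - t) *: a + t *: b)) ->
  F a + m / 2 * enorm (b - a) ^+ 2 <= F b.
Proof.
move=> H1 H2.
apply: (@ler_of_small _ _ _ (m / 2 * enorm (b - a) ^+ 2)) => t t01.
have := le_trans (H2 t t01) (H1 t t01); have /andP[t0 _] := t01.
set E := enorm _ ^+ 2 => H; rewrite -(ler_pM2l t0); lra.
Qed.

Lemma sqr_enorm_conv (a b : 'rV[R]_n) t : enorm ((1 - t) *: a + t *: b) ^+ 2 =
  (1 - t) * enorm a ^+ 2 + t * enorm b ^+ 2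
  - t * (1 - t) * enorm (b - a) ^+ 2.
Proof.
rewrite (enorm_sqrD (_ *: a)) enorm_sqrB !enormZ !exprMn !real_normK ?num_real//.
rewrite dotZl dotZr (dotC b); ring.
Qed.

End Convexity.

(** * Differential calculus *)

Section Calculus.
Context {R : realType}.

(** The quadratic error disappears in the difference quotient, so first-order information is read
    off from inequalities on (0,1] alone. *)
Lemma is_derive_le (phi : R -> R^o) (L A c : R) :
  is_derive (0 : R) (1 : R) phi L ->
  (forall t, 0 < t <= 1 -> phi t - phi 0 <= t * A + t ^+ 2 * c) -> L <= A.
Proof.
move=> dphi H; apply/ler_addgt0Pr => e e0.
have /cvgrPdist_lt/(_ _ e0) : (fun h => h^-1 *: (phi (h *: 1 + 0) - phi 0)) @ 0^' --> L.
  by case: dphi => /[swap] <-; exact.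
rewrite near_withinE => /nbhs_ballP[d /= d0 Hd].
pose d1 := Num.min 1 (d / 2).
have d10 : 0 < d1 by rewrite lt_min ltr01 divr_gt0.
have [d11 d1d] : d1 <= 1 /\ d1 < d.
  by split; rewrite /d1 ?ge_min ?lexx ?gt_min//; apply/orP; right; lra.
rewrite -lerBlDr; apply: (@ler_of_small _ _ _ (d1 * c)) => t /andP[t0 t1].
have td0 : 0 < t * d1 by rewrite mulr_gt0.
have tdd1 : t * d1 <= d1 by rewrite ler_piMl// ltW.
have : `|L - (t * d1)^-1 *: (phi ((t * d1) *: 1 + 0) - phi 0)| < e.
  apply: Hd; last by rewrite gt_eqF.
  by rewrite /ball /= sub0r normrN gtr0_norm// (le_lt_trans tdd1).
rewrite addr0 [_ *: 1]mulr1 ltr_norml => /andP[_].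
have td01 : 0 < t * d1 <= 1 by rewrite td0 (le_trans tdd1).
have := H _ td01; rewrite -(ler_pM2l (x := (t * d1)^-1)) ?invr_gt0//.
have -> : (t * d1)^-1 * (t * d1 * A + (t * d1) ^+ 2 * c) = A + t * (d1 * c).
  by field; rewrite ?gt_eqF.
by rewrite -[_ *: _]/(_ * _); lra.
Qed.

Lemma MVT01 (phi dphi : R -> R) :
  (forall t : R, 0 <= t <= 1 -> is_derive t (1 : R) (phi : R -> R^o) (dphi t)) ->
  exists2 t : R, 0 <= t <= 1 & phi 1 - phi 0 = dphi t.
Proof.
move=> H.
have [||c] := @MVT_segment R phi dphi 0 1 ler01.
- by move=> t /[!in_itv]/= /andP[t0 t1]; apply: H; rewrite !ltW.
- apply: derivable_within_continuous => t /[!in_itv]/= t01.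
  by have [] := H t t01.
- by rewrite in_itv/= subr0 mulr1; exists c.
Qed.

Lemma is_derive_chain {V W : normedModType R} (F : V -> W) (c : R -> V) t w :
  differentiable F (c t) -> is_derive t (1 : R) c w ->
  is_derive t (1 : R) (F \o c) ('D_w F (c t)).
Proof.
move=> dF [dc cw]; have /derivable1_diffP dc' := dc.
have dFc : differentiable (F \o c) t by exact: differentiable_comp.
apply: DeriveDef; first exact/derivable1_diffP.
rewrite deriveE// diff_comp//= deriveE//; congr ('d F _ _).
by rewrite -cw deriveE.
Qed.

Lemma is_derive_line {V : normedModType R} (a b : V) (t : R) :
  is_derive t (1 : R) (fun s : R => a + s *: b) b.
Proof.
rewrite -[X in is_derive _ _ _ X]add0r; apply: is_deriveD.
have -> : b = 1 *: b by rewrite scale1r.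
apply: DeriveDef; last first.
  by rewrite deriveE ?diff_val//= !scale1r.
exact/derivable1_diffP.
Qed.

(** The mean value theorem is available for real-valued functions, so vector-valued maps are treated
    coordinate by coordinate. *)
Lemma derive_coord {V : normedModType R} {n} (F : V -> 'rV[R]_n) p v i :
  differentiable F p ->
  differentiable (fun q => F q 0 i : R^o) p /\
  'D_v (fun q => F q 0 i : R^o) p = 'D_v F p 0 i.
Proof.
move=> dF.
have lin : linear (fun N : 'rV[R]_n => N 0 i : R^o) by move=> a x y; rewrite !mxE.
pose lM := GRing.isLinear.Build _ _ _ _ _ lin.
pose L : {linear 'rV[R]_n -> R^o} := HB.pack (fun N : 'rV[R]_n => N 0 i : R^o) lM.
have cL : continuous L by exact: coord_continuous.
have dL : differentiable L (F p) by exact: linear_differentiable.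
have dLF : differentiable (L \o F) p by exact: differentiable_comp.
split; first exact: dLF.
have -> : (fun q => F q 0 i : R^o) = L \o F by [].
rewrite deriveE// diff_comp// -[LHS]/('d L (F p) ('d F p v)) (diff_lin _ cL).
by rewrite deriveE.
Qed.

Lemma is_derive_dot {n} (a : 'rV[R]_n) (c : R -> 'rV[R]_n) t w :
  is_derive t (1 : R) c w -> is_derive t (1 : R) (fun s => dot a (c s) : R^o) (dot a w).
Proof.
move=> [dc <-]; have /derivable1_diffP dc' := dc.
have -> : (fun s => dot a (c s) : R^o) =
    \sum_(i < n) (a 0 i *: (fun s => c s 0 i : R^o)) by rewrite fct_sumE.
apply: is_derive_sum => i; apply: is_deriveZ.
have [dci <-] := derive_coord (1 : R^o) i dc'.
by apply: DeriveDef => //; exact/derivable1_diffP.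
Qed.

Lemma derive_dot_gradient {n} (F : 'rV[R]_n -> R^o) x w :
  differentiable F x -> 'D_w F x = dot (gradient F x) w.
Proof.
move=> dF; rewrite deriveE// [in LHS](row_sum_delta w) linear_sum.
by apply: eq_bigr => i _; rewrite linearZ mxE mulrC deriveE.
Qed.

Lemma enorm_bounded {n} (A : set 'rV[R]_n) : compact A ->
  exists2 c, 0 < c & forall x, A x -> enorm x <= c.
Proof.
move=> /compact_bounded[c [_ Hc]].
have c0 : 0 < `|c| + 1 by rewrite ltr_wpDl.
exists (n.+1%:R * (`|c| + 1)); first by rewrite mulr_gt0.
move=> x Ax; rewrite (le_trans (enorm_le_norm _))// ler_pM// ?ler_nat//.
by apply: Hc => //; rewrite (le_lt_trans (ler_norm c))// ltrDl.
Qed.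

End Calculus.

(** * The coupling function f and its partial gradients *)

Section Coupling.
Context {R : realType} {n1 n2 : nat}.
Variables (f : 'rV[R]_n1 -> 'rV[R]_n2 -> R).
Hypothesis C1f : Ck_on 1 [set: 'rV[R]_n1 * 'rV[R]_n2] (fun p => f p.1 p.2 : R^o).

Lemma differentiable_fx x y : differentiable (f^~ y : _ -> R^o) x.
Proof.
have [/(_ (x, y) I) df _] := C1f.
have -> : (f^~ y : _ -> R^o) =
  (fun p : 'rV[R]_n1 * 'rV[R]_n2 => f p.1 p.2 : R^o) \o (fun z => (z, y)) by [].
by apply: differentiable_comp => //; exact: differentiable_pair.
Qed.

Lemma differentiable_fy x y : differentiable (f x : _ -> R^o) y.
Proof.
have [/(_ (x, y) I) df _] := C1f.
have -> : (f x : _ -> R^o) =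
  (fun p : 'rV[R]_n1 * 'rV[R]_n2 => f p.1 p.2 : R^o) \o (fun z => (x, z)) by [].
by apply: differentiable_comp => //; exact: differentiable_pair.
Qed.

Lemma is_derive_fx (c : R -> 'rV[R]_n1) w t y : is_derive t (1 : R) c w ->
  is_derive t (1 : R) (fun s => f (c s) y : R^o) (dot (grad_x f (c t) y) w).
Proof.
move=> dc; rewrite -derive_dot_gradient; last exact: differentiable_fx.
by apply: (is_derive_chain (F := f^~ y : _ -> R^o)) => //; exact: differentiable_fx.
Qed.

Lemma is_derive_fy (c : R -> 'rV[R]_n2) w t x : is_derive t (1 : R) c w ->
  is_derive t (1 : R) (fun s => f x (c s) : R^o) (dot (grad_y f x (c t)) w).
Proof.
move=> dc; rewrite -derive_dot_gradient; last exact: differentiable_fy.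
by apply: (is_derive_chain (F := f x : _ -> R^o)) => //; exact: differentiable_fy.
Qed.

Lemma f_continuous : continuous (fun p : 'rV[R]_n1 * 'rV[R]_n2 => f p.1 p.2 : R^o).
Proof. by have [df _] := C1f => p; apply: differentiable_continuous; exact: df. Qed.

(** As a joint directional derivative, a partial derivative inherits the joint continuity contained
    in the C^1 hypothesis. *)
Lemma grad_x_coord x y i : grad_x f x y 0 i =
  'D_(delta_mx 0 i, 0) (fun p => f p.1 p.2 : R^o) (x, y).
Proof.
rewrite mxE /derive.
suff -> : (fun h : R => h^-1 *: (f (h *: delta_mx 0 i + x) y - f x y) : R^o) =
  (fun h : R => h^-1 *: (f (h *: delta_mx 0 i + x) (h *: 0 + y) - f x y) : R^o) by [].
by apply/funext => h; rewrite scaler0 add0r.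
Qed.

Lemma grad_x_bounded M S : compact M -> compact S ->
  exists2 G, 0 < G & forall x y, M x -> S y -> enorm (grad_x f x y) <= G.
Proof.
move=> cM cS; have [_ Cf] := C1f.
have H i : exists2 G, 0 < G & forall x y, M x -> S y -> `|grad_x f x y 0 i| <= G.
  pose D := 'D_(delta_mx 0 i, 0) (fun p : 'rV[R]_n1 * 'rV[R]_n2 => f p.1 p.2 : R^o).
  have : compact (D @` (M `*` S)).
    apply: continuous_compact; last exact: compact_setX.
    by apply: continuous_subspaceT => p; apply: Cf.
  move=> /compact_bounded[c [_ Hc]]; exists (`|c| + 1); first by rewrite ltr_wpDl.
  move=> x y Mx Sy; rewrite grad_x_coord; apply: Hc; last by exists (x, y).
  by rewrite (le_lt_trans (ler_norm c))// ltrDl.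
pose G i := sval (cid2 (H i)).
have [G0 HG] : (forall i, 0 < G i) /\
   forall i x y, M x -> S y -> `|grad_x f x y 0 i| <= G i.
  by split => i; rewrite /G; case: cid2.
exists (n1%:R * (\sum_i G i) + 1).
  by rewrite ltr_wpDl// mulr_ge0// sumr_ge0// => i _; rewrite ltW.
move=> x y Mx Sy; rewrite (@le_trans _ _ (n1%:R * \sum_i G i)) ?lerDl//.
apply: enorm_le_coord => [|i]; first by rewrite sumr_ge0// => i _; rewrite ltW.
rewrite (le_trans (HG i x y Mx Sy))// (bigD1 i)//= lerDl.
by rewrite sumr_ge0// => k _; rewrite ltW.
Qed.

(** Mean value theorem for f(x', .) - f(x, .) on the segment from y to y', which stays in S. The
    mixed difference is symmetric in the two variables, so this bound also controls how the
    x-gradient depends on y. *)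
Lemma f_cross_difference (M : set 'rV[R]_n1) (S : set 'rV[R]_n2) Ly :
  cvxset S -> 0 < Ly ->
  (forall x1 x2 y1 y2, M x1 -> M x2 -> S y1 -> S y2 ->
            enorm (grad_y f x1 y1 - grad_y f x2 y2) ^+ 2 <=
            Ly ^+ 2 * (enorm (x1 - x2) ^+ 2 + enorm (y1 - y2) ^+ 2)) ->
  forall x x' y y', M x -> M x' -> S y -> S y' ->
  f x' y' - f x y' - (f x' y - f x y) <= Ly * enorm (x' - x) * enorm (y' - y).
Proof.
move=> cS Ly0 HL x x' y y' Mx Mx' Sy Sy'.
pose c (t : R) := y + t *: (y' - y).
have Sc t : 0 <= t <= 1 -> S (c t).
  move=> t01; have := cS _ _ _ Sy' Sy t01.
  by rewrite /c scalerBr scalerBl scale1r addrCA addrA addrAC -addrA addrC.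
have dphi t : is_derive t (1 : R) (fun s => f x' (c s) - f x (c s) : R^o)
   (dot (grad_y f x' (c t) - grad_y f x (c t)) (y' - y)).
  rewrite dotBl; apply: is_deriveB; apply: is_derive_fy; exact: is_derive_line.
have [t t01] := MVT01 (fun t _ => dphi t).
rewrite /c scale0r scale1r addr0 addrC (addrC y) subrK -/(c t) addrC => ->.
rewrite (le_trans (cauchy_schwarz _ _))// ler_wpM2r ?enorm_ge0//.
rewrite -ler_sqr ?nnegrE ?mulr_ge0 ?enorm_ge0// ?(ltW Ly0)//.
have := HL _ _ _ _ Mx' Mx (Sc t t01) (Sc t t01).
by rewrite subrr enorm0 expr0n /= addr0 exprMn.
Qed.

End Coupling.

(** * Taylor expansion in the fiber variable, uniform in the base point *)

Section FiberwiseTaylor.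
Context {R : realType} {n : nat}.
Local Notation W := ('rV[R]_n * 'rV[R]_n)%type.
Implicit Types (F : W -> 'rV[R]_n) (U : set W) (p : W).

Let e (i : 'I_n) : W := (0, delta_mx 0 i).

Lemma derive_fiber_sum F q w : differentiable F q ->
  'D_((0 : 'rV[R]_n), w) F q = \sum_i w 0 i *: 'D_(e i) F q.
Proof.
move=> dF; have -> : ((0 : 'rV[R]_n), w) = \sum_i w 0 i *: e i.
  rewrite [RHS]surjective_pairing; congr pair.
    by rewrite (raddf_sum fst)/= big1// => i _; rewrite scaler0.
  by rewrite (raddf_sum snd)/= [LHS]row_sum_delta.
rewrite deriveE ?linear_sum//.
by apply: eq_bigr => i _; rewrite linearZ deriveE.
Qed.

(** The derivative is a linear combination of finitely many partial derivatives, each continuous at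
    p and hence within 1 of its value there. *)
Lemma derive_fiber_bounded U F p : Ck_on 1 U F -> open U -> U p ->
  exists2 K, 0 < K & \forall q \near p,
    forall w, `|'D_((0 : 'rV[R]_n), w) F q| <= K * enorm w.
Proof.
move=> [dF CF] oU Up.
pose K i := `|'D_(e i) F p| + 1.
have K0 i : 0 < K i by rewrite ltr_wpDl.
exists (\sum_i K i + 1); first by rewrite ltr_wpDl// sumr_ge0// => i _; rewrite ltW.
have HK : \forall q \near p, forall i, `|'D_(e i) F q| <= K i.
  have FF : Filter (nbhs p) := nbhs_filter p.
  apply: (@filter_forall W _ (fun i q => `|'D_(e i) F q| <= K i) (nbhs p)) => i.
  have /cvgrPdist_lt/(_ _ ltr01) := CF (e i) p Up.
  apply: filterS => q /= Hq; rewrite /K -lerBlDl.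
  rewrite (le_trans _ (ltW Hq))// distrC; exact: lerB_dist.
have HU : \forall q \near p, U q by exact: open_nbhs_nbhs.
near=> q => w.
have Uq : U q by near: q.
have Kq : forall i, `|'D_(e i) F q| <= K i by near: q.
rewrite derive_fiber_sum; last exact: dF.
rewrite (le_trans (ler_norm_sum _ _ _))//.
rewrite (@le_trans _ _ ((\sum_i K i) * enorm w)) ?ler_wpM2r ?enorm_ge0 ?lerDl//.
rewrite mulr_suml; apply: ler_sum => i _; rewrite normrZ mulrC.
by apply: ler_pM => //; exact: coord_le_enorm.
Unshelve. all: by end_near. Qed.

(** A product neighbourhood of (x, 0) contains, for all base points near x, the segments from 0 to
    vectors of a fixed length. *)
Lemma near_fiber (x : 'rV[R]_n) (P : W -> Prop) :
  (\forall q \near ((x, 0) : W), P q) ->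
  exists2 d, 0 < d & \forall z \near x, forall u t,
    enorm u <= d -> 0 <= t <= 1 -> P (z, t *: u).
Proof.
case=> -[A1 A2] /= [xA1 /nbhs_ballP[d /= d0 HA2]] H.
exists (d / 2); first by rewrite divr_gt0.
near=> z => u t ud /andP[t0 t1]; apply: H; split => /=; first by near: z.
apply: HA2; rewrite -ball_normE /= sub0r normrN normrZ ger0_norm//.
rewrite (@le_lt_trans _ _ (enorm u))//; last by lra.
by rewrite (le_trans _ (norm_le_enorm u))// ler_piMl.
Unshelve. all: by end_near. Qed.

Lemma is_derive_fiber U F z u t : (forall q, U q -> differentiable F q) ->
  U (z, t *: u) ->
  is_derive t (1 : R) (fun s : R => F (z, s *: u)) ('D_((0 : 'rV[R]_n), u) F (z, t *: u)).
Proof.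
move=> dF Uz.
have -> : (fun s : R => F (z, s *: u)) = F \o (fun s : R => (z, 0) + s *: (0, u) : W).
  apply/funext => s /=; congr F; apply/pair_equal_spec => /=.
  by rewrite scaler0 addr0 add0r.
have -> : (z, t *: u) = (fun s : R => (z, 0) + s *: (0, u) : W) t.
  by apply/pair_equal_spec => /=; rewrite scaler0 addr0 add0r.
apply: is_derive_chain; last exact: is_derive_line.
rewrite (_ : _ + _ = (z, t *: u)); first exact: dF.
by apply/pair_equal_spec => /=; rewrite scaler0 addr0 add0r.
Qed.

Lemma is_derive_fiber_coord U F z u t i : (forall q, U q -> differentiable F q) ->
  U (z, t *: u) ->
  is_derive t (1 : R) (fun s : R => F (z, s *: u) 0 i : R^o)
    ('D_((0 : 'rV[R]_n), u) F (z, t *: u) 0 i).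
Proof.
move=> dF Ut; have [dc Dc] := is_derive_fiber dF Ut.
have dc' : differentiable (fun s : R => F (z, s *: u)) t by exact/derivable1_diffP.
have [df E] := derive_coord (1 : R^o) i dc'.
apply: DeriveDef; first exact/derivable1_diffP.
by rewrite E Dc.
Qed.

Lemma fiber_lipschitz U F z u B :
  (forall q, U q -> differentiable F q) ->
  (forall t, 0 <= t <= 1 -> U (z, t *: u) /\
     `|'D_((0 : 'rV[R]_n), u) F (z, t *: u)| <= B) ->
  `|F (z, u) - F (z, 0)| <= B.
Proof.
move=> dF HB.
have B0 : 0 <= B.
  by have := HB 0; rewrite lexx ler01 => /(_ isT)[_]; exact: le_trans.
apply: norm_le_coord => // i.
have dphi (t : R) : 0 <= t <= 1 -> is_derive t (1 : R) (fun s : R => F (z, s *: u) 0 i : R^o)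
    ('D_((0 : 'rV[R]_n), u) F (z, t *: u) 0 i).
  by move=> t01; apply: is_derive_fiber_coord dF _; have [] := HB t t01.
have [t t01] := MVT01 dphi.
rewrite scale0r scale1r !mxE => ->.
by rewrite (le_trans (coord_le_norm _ _))//; have [] := HB t t01.
Qed.

(** Two applications of the mean value theorem: to F minus its linear part, then to the partial
    derivatives of F, each contributing one factor |u|. *)
Lemma fiber_taylor U F (x : 'rV[R]_n) : Ck_on 2 U F -> open U -> U (x, 0) ->
  exists K d, [/\ 0 < K, 0 < d & \forall z \near x, forall u, enorm u <= d ->
    [/\ forall t, 0 <= t <= 1 -> U (z, t *: u) /\
          `|'D_((0 : 'rV[R]_n), u) F (z, t *: u)| <= K * enorm u
      & `|F (z, u) - F (z, 0) - 'D_((0 : 'rV[R]_n), u) F (z, 0)|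
          <= K * enorm u ^+ 2]].
Proof.
move=> C2F oU Ux.
have [dF CF] := C2F.
have C1F : Ck_on 1 U F.
  by split=> // v q Uq; apply: differentiable_continuous; have [dDF _] := CF v; exact: dDF.
have [K1 K10 H1] := derive_fiber_bounded C1F oU Ux.
have H2 i : exists2 K, 0 < K & \forall q \near ((x, 0) : W),
    forall w, `|'D_((0 : 'rV[R]_n), w) ('D_(e i) F) q| <= K * enorm w.
  exact: (derive_fiber_bounded (CF (e i)) oU Ux).
pose k i := sval (cid2 (H2 i)).
have [k0 Hk] : (forall i, 0 < k i) /\ forall i, \forall q \near ((x, 0) : W),
    forall w, `|'D_((0 : 'rV[R]_n), w) ('D_(e i) F) q| <= k i * enorm w.
  by split => i; rewrite /k; case: cid2.
have sk0 : 0 <= \sum_i k i by rewrite sumr_ge0// => i _; rewrite ltW.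
have HU : \forall q \near ((x, 0) : W), U q by exact: open_nbhs_nbhs.
have [d d0 Hd] := near_fiber (filterI HU (filterI H1 (filter_forall _ Hk))).
exists (K1 + \sum_i k i), d; split => //; first by rewrite ltr_wpDr.
near=> z => u ud.
have Hz : forall u t, enorm u <= d -> 0 <= t <= 1 -> U (z, t *: u) /\
   (forall w, `|'D_((0 : 'rV[R]_n), w) F (z, t *: u)| <= K1 * enorm w) /\
   forall i w, `|'D_((0 : 'rV[R]_n), w) ('D_(e i) F) (z, t *: u)| <= k i * enorm w.
  near: z; apply: filterS Hd => z Hz u' t u'd t01.
  by have [? []] := Hz u' t u'd t01.
have K1u : K1 * enorm u <= (K1 + \sum_i k i) * enorm u.
  by rewrite ler_wpM2r ?enorm_ge0// lerDl.
split => [t t01|].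
  have [Ut [H _]] := Hz u t ud t01; split=> //.
  exact: le_trans (H u) K1u.
set D := 'D__ F (z, 0).
have B0 : 0 <= (\sum_i k i) * enorm u ^+ 2 by rewrite mulr_ge0 ?sqr_ge0.
rewrite (@le_trans _ _ ((\sum_i k i) * enorm u ^+ 2))//; last first.
  by rewrite ler_wpM2r ?sqr_ge0// lerDr ltW.
apply: norm_le_coord => // i.
have dphi (t : R) : 0 <= t <= 1 ->
    is_derive t (1 : R) (fun s : R => F (z, s *: u) 0 i - s * D 0 i : R^o)
      ('D_((0 : 'rV[R]_n), u) F (z, t *: u) 0 i - D 0 i).
  move=> t01; apply: is_deriveB.
    by apply: is_derive_fiber_coord dF _; have [] := Hz u t ud t01.
  have := is_derive_line (0 : R^o) (D 0 i : R^o) t.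
  rewrite (_ : (fun _ => _) = (fun s : R => s * D 0 i : R^o))//.
  by apply/funext => s; rewrite add0r.
have [t t01] := MVT01 dphi; have /andP[t0 t1] := t01.
rewrite scale0r scale1r mul0r mul1r subr0 !mxE => E.
have -> : F (z, u) 0 i - F (z, 0) 0 i - D 0 i = F (z, u) 0 i - D 0 i - F (z, 0) 0 i.
  by rewrite addrAC.
rewrite E.
have [Ut [H _]] := Hz u t ud t01.
have U0 : U (z, 0).
  by have [|+ _] := Hz u 0 ud; rewrite ?lexx ?ler01// scale0r.
rewrite /D !derive_fiber_sum; [|exact: dF..].
(* Linearity in the direction u reduces the difference of derivatives to differences of coordinate
   derivatives, to which [fiber_lipschitz] applies. *)
have -> : (\sum_j u 0 j *: 'D_(e j) F (z, t *: u)) 0 i - (\sum_j u 0 j *: 'D_(e j) F (z, 0)) 0 i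
   = (\sum_j u 0 j *: ('D_(e j) F (z, t *: u) - 'D_(e j) F (z, 0))) 0 i.
  by under [in RHS]eq_bigr do rewrite scalerBr; rewrite sumrB !mxE.
rewrite (le_trans (coord_le_norm _ _))// (le_trans (ler_norm_sum _ _ _))//.
rewrite mulr_suml; apply: ler_sum => j _; rewrite normrZ expr2 mulrCA.
apply: ler_pM => //; first exact: coord_le_enorm.
have tu : enorm (t *: u) <= enorm u by rewrite enormZp// ler_piMl ?enorm_ge0.
apply: (@le_trans _ _ (k j * enorm (t *: u))); last by rewrite ler_wpM2l// ltW.
apply: (@fiber_lipschitz U ('D_(e j) F) z (t *: u)) => [q Uq|s s01].
  by have [dDF _] := CF (e j); exact: dDF.
have [? [_ ?]] := Hz (t *: u) s (le_trans tu ud) s01; split=> //.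
Unshelve. all: by end_near. Qed.

End FiberwiseTaylor.

(** * Retractions *)

Section Retraction.
Context {R : realType} {n : nat}.
Variables (M : set 'rV[R]_n) (retr : 'rV[R]_n -> 'rV[R]_n -> 'rV[R]_n).

Lemma tangent_spaceZ z u (t : R) : tangent_space M z u -> tangent_space M z (t *: u).
Proof. by move=> Tu m U phi Hphi; rewrite linearZ/= (Tu _ U phi Hphi) scaler0. Qed.

Lemma tangent_space0 z : tangent_space M z 0.
Proof. by move=> m U phi Hphi; rewrite linear0. Qed.

Lemma tangent_spaceD z u v : tangent_space M z u -> tangent_space M z v ->
  tangent_space M z (u + v).
Proof. by move=> Tu Tv m U phi Hphi; rewrite linearD (Tu _ U phi Hphi) (Tv _ U phi Hphi) addr0. Qed.

Hypothesis retrM : retraction M retr.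

Lemma retraction_in z u : M z -> tangent_space M z u -> M (retr z u).
Proof. by case: retrM => H _ _ _ Mz Tu; exact: (H (z, u)). Qed.

Let curve_bounds K z u := enorm (retr z u - z - u) <= K * enorm u ^+ 2 /\
  forall t : R, 0 <= t <= 1 ->
    exists2 w, is_derive t (1 : R) (fun s : R => retr z (s *: u)) w
             & enorm w <= K * enorm u.

(** Taylor expansion of a local smooth extension F of the retraction. On tangent vectors F(z, 0) = z
    and the fiber derivative at 0 is u, so the remainder is R_z(u) - z - u. *)
Lemma retraction_local x : M x -> exists K d, [/\ 0 < K, 0 < d &
  \forall z \near x, M z -> forall u, tangent_space M z u -> enorm u <= d ->
     curve_bounds K z u].
Proof.
case: retrM => _ Rsm R0 RD Mx.
have [U [F [oU Ux smF RF]]] := Rsm (x, 0) (conj Mx (@tangent_space0 x)).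
have [dF _] := smF 1%N.
have [K [d [K0 d0 H]]] := fiber_taylor (smF 2%N) oU Ux.
exists (n.+1%:R * K), d; split=> //; first by rewrite mulr_gt0.
apply: filterS H => z H Mz u Tu ud.
have [H1 H2] := H u ud.
(* F agrees with the retraction only on the tangent bundle, but the whole line through u stays in
   it, so the two curves have the same derivatives. *)
have near_eq (t : R) : 0 <= t <= 1 ->
    \near t, F (z, t *: u) = retr z (t *: u).
  move=> t01; have [Ut _] := H1 t t01.
  have : \forall s \near t, U (z, s *: u).
    have c : {for t, continuous (fun s : R => (z, s *: u))}.
      by apply: differentiable_continuous; exact: differentiable_pair.
    exact: (c _ (open_nbhs_nbhs (conj oU Ut))).
  apply: filterS => s Us; rewrite -(RF (z, s *: u))//; split=> //=.
  exact: tangent_spaceZ.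
have dretr (t : R) : 0 <= t <= 1 -> is_derive t (1 : R) (fun s : R => retr z (s *: u))
    ('D_((0 : 'rV[R]_n), u) F (z, t *: u)).
  move=> t01; have [Ut _] := H1 t t01.
  exact: (near_eq_is_derive (near_eq t t01) (is_derive_fiber dF Ut)).
have bound (w : 'rV[R]_n) B : 0 <= B -> `|w| <= K * B -> enorm w <= n.+1%:R * K * B.
  move=> B0 wB; rewrite (le_trans (enorm_le_norm _))// -mulrA.
  by apply: ler_pM => //; rewrite ler_nat.
have t0 : 0 <= (0 : R) <= 1 by rewrite lexx ler01.
have t1 : 0 <= (1 : R) <= 1 by rewrite lexx ler01.
split => [|t t01]; last first.
  by exists ('D_((0 : 'rV[R]_n), u) F (z, t *: u)); [exact: dretr|
    apply: bound; rewrite ?enorm_ge0//; have [] := H1 t t01].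
(* The same curve is differentiated at 0 in two ways: through F and by the axiom DR_x(0)[v] = v. *)
have D0 : 'D_((0 : 'rV[R]_n), u) F (z, 0) = u.
  have [_] := RD z u Mz Tu; have [_] := dretr 0 t0.
  by rewrite scale0r => -> ->.
have F0 : F (z, 0) = z.
  by have := nbhs_singleton (near_eq 0 t0); rewrite scale0r R0.
have F1 : F (z, u) = retr z u.
  by have := nbhs_singleton (near_eq 1 t1); rewrite scale1r.
apply: bound; first exact: sqr_ge0.
by move: H2; rewrite D0 F0 F1.
Qed.

(** One large [K] serves both as the constant and as the inverse radius: the property then persists
    when [K] grows, and compactness of M applies with [K] near infinity. *)
Lemma retraction_near_zero : compact M -> exists2 K, 0 < K &
  forall z u, M z -> tangent_space M z u -> enorm u <= K^-1 -> curve_bounds K z u.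
Proof.
move=> /compact_near_coveringP cM.
pose P (K : R) z := M z -> forall u, tangent_space M z u ->
  enorm u <= K^-1 -> curve_bounds K z u.
have : \forall K \near +oo, M `<=` P K.
  apply: cM => x /retraction_local[K [d [K0 d0 H]]].
  near=> z L => Mz u Tu uL.
  have KL : K <= L by near: L; apply: nbhs_pinfty_ge; exact: num_real.
  have dL : d^-1 <= L by near: L; apply: nbhs_pinfty_ge; exact: num_real.
  have L0 : 0 < L by rewrite (lt_le_trans K0).
  have ud : enorm u <= d.
    by rewrite (le_trans uL)// -[d]invrK lef_pV2 ?posrE ?invr_gt0.
  have Hz : M z -> forall u, tangent_space M z u -> enorm u <= d ->
      curve_bounds K z u by near: z.
  have [H1 H2] := Hz Mz u Tu ud; split.
    by rewrite (le_trans H1)// ler_wpM2r ?sqr_ge0.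
  move=> t /H2[w dw wK]; exists w => //.
  by rewrite (le_trans wK)// ler_wpM2r ?enorm_ge0.
move=> H; near (pinfty_nbhs R) => K; exists K.
  by near: K; apply: nbhs_pinfty_gt; exact: num_real.
have HK : M `<=` P K by near: K.
by move=> z u Mz; exact: HK.
Unshelve. all: by end_near. Qed.

(** Short vectors are covered by the Taylor bound. For |u| > 1/K the left side is at most 2m + |u|,
    since M is bounded, and both terms are dominated by |u|^2. *)
Lemma retraction_bounds : compact M -> exists2 K, 0 < K &
  forall z u, M z -> tangent_space M z u ->
    enorm (retr z u - z - u) <= K * enorm u ^+ 2.
Proof.
move=> cM; have [K K0 HK] := retraction_near_zero cM.
have [m m0 Hm] := enorm_bounded cM.
exists (K + (2 * m * K ^+ 2 + K)).
  by rewrite !addr_gt0// !mulr_gt0// exprn_gt0.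
move=> z u Mz Tu; have [uK|uK] := leP (enorm u) K^-1.
  have [H _] := HK z u Mz Tu uK.
  rewrite (le_trans H)// ler_wpM2r ?sqr_ge0// lerDl addr_ge0 ?(ltW K0)//.
  by rewrite !mulr_ge0 ?sqr_ge0// ltW.
have Ku : 1 <= K * enorm u.
  by rewrite -(@mulfV _ K) ?gt_eqF// ler_pM2l// ltW.
have Ku2 : 1 <= K ^+ 2 * enorm u ^+ 2 by rewrite -exprMn expr_ge1// (le_trans ler01).
have := enormB (retr z u - z) u; have := enormB (retr z u) z.
have := Hm _ (retraction_in Mz Tu); have := Hm _ Mz.
have : enorm u <= K * enorm u ^+ 2.
  by rewrite expr2 mulrA ler_peMl ?enorm_ge0.
have : 2 * m <= 2 * m * (K ^+ 2 * enorm u ^+ 2) by rewrite ler_peMr// mulr_ge0// ltW.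
have : 0 <= K * enorm u ^+ 2 by rewrite mulr_ge0 ?sqr_ge0// ltW.
rewrite !mulrDl; lra.
Qed.

(** The quadratic remainder handles |u| <= 1, the diameter of M handles the rest. *)
Lemma retraction_lipschitz : compact M -> exists2 L, 0 < L &
  forall z u, M z -> tangent_space M z u -> enorm (retr z u - z) <= L * enorm u.
Proof.
move=> cM; have [K K0 HK] := retraction_bounds cM.
have [m m0 Hm] := enorm_bounded cM.
exists (K + 1 + 2 * m); first by rewrite !addr_gt0// mulr_gt0.
move=> z u Mz Tu; have u0 := enorm_ge0 u.
have mu0 : 0 <= 2 * m * enorm u by rewrite !mulr_ge0// ltW.
have Ku0 : 0 <= (K + 1) * enorm u by rewrite mulr_ge0// addr_ge0// ltW.
have [u1|u1] := leP (enorm u) 1.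
  have uu : enorm u ^+ 2 <= enorm u by rewrite expr2 ler_piMl.
  have := enormD (retr z u - z - u) u; rewrite subrK.
  have := HK z u Mz Tu; have := ler_wpM2l (ltW K0) uu; lra.
have := enormB (retr z u) z; have := Hm _ (retraction_in Mz Tu); have := Hm _ Mz.
have : 2 * m <= 2 * m * enorm u by rewrite ler_peMr// ?mulr_ge0// ltW.
lra.
Qed.

End Retraction.

(** * Quadratic upper bound for f along the retraction *)

Section SmoothPart.
Context {R : realType} {n1 n2 : nat}.
Variables (M : set 'rV[R]_n1) (S : set 'rV[R]_n2).
Variables (f : 'rV[R]_n1 -> 'rV[R]_n2 -> R).
Variable (retr : 'rV[R]_n1 -> 'rV[R]_n1 -> 'rV[R]_n1).
Variables (Lx Ly : R).
Hypothesis C1f : Ck_on 1 [set: 'rV[R]_n1 * 'rV[R]_n2] (fun p => f p.1 p.2 : R^o).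
Hypotheses (cM : compact M) (cS : compact S) (convS : cvxset S).
Hypothesis retrM : retraction M retr.
Hypotheses (Lx0 : 0 < Lx) (Ly0 : 0 < Ly).
Hypothesis HLx : forall x1 x2 y, M x1 -> M x2 -> S y ->
  enorm (grad_x f x1 y - grad_x f x2 y) <= Lx * enorm (x1 - x2).
Hypothesis HLy : forall x1 x2 y1 y2, M x1 -> M x2 -> S y1 -> S y2 ->
  enorm (grad_y f x1 y1 - grad_y f x2 y2) ^+ 2 <=
  Ly ^+ 2 * (enorm (x1 - x2) ^+ 2 + enorm (y1 - y2) ^+ 2).

Lemma f_bounded : exists2 B, 0 < B & forall x y, M x -> S y -> `|f x y| <= B.
Proof.
have : compact ((fun p : 'rV[R]_n1 * 'rV[R]_n2 => f p.1 p.2 : R^o) @` (M `*` S)).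
  apply: continuous_compact; last exact: compact_setX.
  by apply: continuous_subspaceT; exact: f_continuous.
move=> /compact_bounded[c [_ Hc]]; exists (`|c| + 1); first by rewrite ltr_wpDl.
move=> x y Mx Sy; apply: (Hc (`|c| + 1)); last by exists (x, y).
by rewrite (le_lt_trans (ler_norm c))// ltrDl.
Qed.

(* Away from the zero section everything is bounded while the right-hand side
   is not small, so only short tangent vectors need the smoothness of f. *)
Lemma f_retraction_upper : exists2 K, 0 < K &
  forall x u y, M x -> tangent_space M x u -> S y ->
    f (retr x u) y - f x y - dot (grad_x f x y) u <= K * enorm u ^+ 2.
Proof.
have [K K0 HK] := retraction_near_zero retrM cM.
have [G G0 HG] := grad_x_bounded C1f cM cS.
have [B B0 HB] := f_bounded.
(* The first term bounds the change of the gradient along the curve, the second the defect R_x(u) -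
   x - u; the parenthesis is for long u. *)
exists (Lx * 2 * K + G * K + (2 * B * K ^+ 2 + G * K)).
  by rewrite !addr_gt0// !mulr_gt0// ?exprn_gt0.
have K1 : 0 <= Lx * 2 * K by rewrite !mulr_ge0// // ltW.
have K2 : 0 <= 2 * B * K ^+ 2 + G * K.
  by rewrite !addr_ge0// !mulr_ge0 ?sqr_ge0// ltW.
have K3 : 0 <= G * K by rewrite mulr_ge0// ltW.
move=> x u y Mx Tu Sy.
have dotG w : dot (grad_x f x y) w <= G * enorm w.
  by rewrite (le_trans (cauchy_schwarz _ _))// ler_wpM2r ?enorm_ge0// HG.
have [uK|uK] := leP (enorm u) K^-1; last first.
  have Ku : 1 <= K * enorm u.
    by rewrite -(@mulfV _ K) ?gt_eqF// ler_pM2l// ltW.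
  have Ku2 : 1 <= K ^+ 2 * enorm u ^+ 2 by rewrite -exprMn expr_ge1// (le_trans ler01).
  have E1 : G * enorm u <= G * K * enorm u ^+ 2.
    by rewrite expr2 -mulrA mulrA -mulrA ler_wpM2l ?(ltW G0)// mulrA ler_peMl ?enorm_ge0.
  have E2 : 2 * B <= 2 * B * (K ^+ 2 * enorm u ^+ 2).
    by rewrite ler_peMr// mulr_ge0// ltW.
  have := HB _ _ (retraction_in retrM Mx Tu) Sy; have := HB _ _ Mx Sy.
  rewrite !ler_norml => /andP[? ?] /andP[? ?].
  have := dotG (- u); rewrite dotNr enormN => ?.
  have ? : 0 <= (Lx * 2 * K + G * K) * enorm u ^+ 2.
    by rewrite mulr_ge0 ?sqr_ge0// addr_ge0.
  rewrite mulrDl; lra.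
have [Hr Hd] := HK x u Mx Tu uK.
pose c (t : R) := retr x (t *: u).
have Mc t : M (c t) by apply: (retraction_in retrM) => //; exact: tangent_spaceZ.
pose w (t : R) := if pselect (0 <= t <= 1) is left t01 then s2val (cid2 (Hd t t01)) else 0.
have Hw (t : R) : 0 <= t <= 1 -> is_derive t (1 : R) c (w t) /\ enorm (w t) <= K * enorm u.
  by move=> t01; rewrite /w; case: pselect => // t01'; case: cid2.
(* Subtracting the linear part turns the derivative into a gradient difference. The path is the
   retraction curve and not a segment because the [Lx] bound holds only between points of M. *)
have dphi (t : R) : 0 <= t <= 1 -> is_derive t (1 : R)
    (fun s => f (c s) y - dot (grad_x f x y) (c s) : R^o)
    (dot (grad_x f (c t) y - grad_x f x y) (w t)).
  move=> t01; have [dc _] := Hw t t01.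
  rewrite dotBl; apply: is_deriveB; first exact: is_derive_fx.
  exact: is_derive_dot.
have [t t01] := MVT01 dphi; have /andP[t0 t1] := t01.
rewrite /c scale0r scale1r  -/(c t); case: (retrM) => _ _ -> // _ Hphi.
have ct : enorm (c t - x) <= 2 * enorm u.
  have := (HK x (t *: u) Mx (tangent_spaceZ t Tu)).
  have tu : enorm (t *: u) <= enorm u by rewrite enormZp// ler_piMl ?enorm_ge0.
  move=> /(_ (le_trans tu uK))[Ht _].
  have -> : c t - x = (c t - x - t *: u) + t *: u by rewrite subrK.
  rewrite (le_trans (enormD _ _))// mulr_natl mulr2n lerD// (le_trans Ht)//.
  rewrite (@le_trans _ _ (K * enorm u * enorm u))//.
    by rewrite -mulrA ler_wpM2l ?(ltW K0)// expr2 ler_pM ?enorm_ge0.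
  by rewrite ler_piMl ?enorm_ge0// -(@mulfV _ K) ?gt_eqF// ler_pM2l.
have [_ wu] := Hw t t01.
have : dot (grad_x f (c t) y - grad_x f x y) (w t) <= Lx * 2 * K * enorm u ^+ 2.
  rewrite (le_trans (cauchy_schwarz _ _))// expr2.
  have -> : Lx * 2 * K * (enorm u * enorm u) = (Lx * (2 * enorm u)) * (K * enorm u) by ring.
  apply: ler_pM; rewrite ?enorm_ge0// (le_trans (HLx (Mc t) Mx Sy))//.
  by rewrite ler_wpM2l// ltW.
rewrite -Hphi => {Hphi} H.
have := dotG (retr x u - x - u); rewrite !dotBr => H2.
have H3 : G * enorm (retr x u - x - u) <= G * (K * enorm u ^+ 2) by rewrite ler_wpM2l ?(ltW G0).
have : 0 <= (2 * B * K ^+ 2 + G * K) * enorm u ^+ 2 by rewrite mulr_ge0 ?sqr_ge0.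
lra.
Qed.
End SmoothPart.

(** * The regularized dual problem *)

Lemma ler_sqrB {R : realType} (u w c d : R) : 0 <= u -> 0 <= w -> 0 <= d ->
  u <= c -> w <= c -> u <= w + d -> u ^+ 2 - w ^+ 2 <= 2 * c * d.
Proof.
move=> u0 w0 d0 uc wc uwd; have c0 := le_trans u0 uc.
have [uw|wu] := leP u w.
  have : u ^+ 2 <= w ^+ 2 by rewrite ler_sqr.
  have : 0 <= 2 * c * d by rewrite !mulr_ge0.
  lra.
rewrite subr_sqr mulrC; apply: ler_pM; lra.
Qed.

Lemma enorm_sqr_continuous {R : realType} {n : nat} (a : 'rV[R]_n) :
  continuous (fun y : 'rV[R]_n => enorm (y - a) ^+ 2).
Proof.
under eq_fun do rewrite enorm_sqr.
apply: continuous_big => [|i _ y]; first exact: add_continuous.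
have H : {for y, continuous (fun z : 'rV[R]_n => (z - a) 0 i : R^o)}.
  have d : differentiable (fun z : 'rV[R]_n => z - a) y by [].
  by apply: differentiable_continuous; have [] := derive_coord 0 i d.
exact: (continuousM H H).
Qed.

(** Continuity of g is bypassed: phi(y) - s is continuous and is maximized over the part of the
    closed epigraph above S with bounded height, which is compact. *)
Lemma sub_closed_convex_attains_max {R : realType} {n : nat} (S : set 'rV[R]_n)
    (phi g : 'rV[R]_n -> R) :
  compact S -> S !=set0 -> continuous phi -> closed_convex g ->
  exists2 y, S y & forall z, S z -> phi z - g z <= phi y - g y.
Proof.
move=> cS [y0 Sy0] cphi [clg /convex_function_cvx cg].
have [m m0 Hm] := enorm_bounded cS.
have [c Hc] := cvx_bounded cg m.
pose A := [set p : 'rV[R]_n * R | g p.1 <= p.2] `&` (S `*` `[-c, c]%classic).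
have cA : compact A.
  rewrite /A setIC; apply: compact_closedI => //.
  by apply: compact_setX => //; exact: segment_compact.
have gA y : S y -> A (y, g y).
  move=> Sy; split => /=; first exact: lexx.
  split=> //=; rewrite in_itv /= -ler_norml; exact: Hc (Hm _ Sy).
have A0 : A !=set0 by exists (y0, g y0); exact: gA.
have cf : {within A, continuous (fun p : 'rV[R]_n * R => phi p.1 - p.2)}.
  apply: continuous_subspaceT => p; apply: cvgB; last exact: cvg_snd.
  by apply: continuous_cvg; [exact: cphi|exact: cvg_fst].
have [[y s] /set_mem[/= gys [Sy _]] H] := compact_EVT_max A0 cA cf.
exists y => // z Sz; have := H (z, g z); rewrite inE => /(_ (gA z Sz))/=.
lra.
Qed.

Section DualProblem.
Context {R : realType} {n1 n2 : nat}.
Variables (M : set 'rV[R]_n1) (S : set 'rV[R]_n2).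
Variables (f : 'rV[R]_n1 -> 'rV[R]_n2 -> R).
Variables (h : 'rV[R]_n1 -> R) (g : 'rV[R]_n2 -> R).
Variables (Lx Ly Lh : R).
Hypothesis PB : minimax_problem M S f h g Lx Ly Lh.

Let cM : compact M. Proof. by case: PB => [[]]. Qed.
Let cS : compact S. Proof. by case: PB => [[]]. Qed.
Let S0 : S !=set0. Proof. by case: PB => [[]]. Qed.
Let convS : cvxset S.
Proof. by apply: convex_set_cvxset; case: PB => [[]]. Qed.
Let C1f : Ck_on 1 [set: 'rV[R]_n1 * 'rV[R]_n2] (fun p => f p.1 p.2 : R^o).
Proof. by case: PB => _ []. Qed.
Let cvxf x : cvx (fun y => - f x y).
Proof. by apply: convex_function_cvx; case: PB => _ [_ H] *; exact: H. Qed.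
Let ccg : closed_convex g. Proof. by case: PB => _ _ []. Qed.
Let cvxg : cvx g. Proof. by apply: convex_function_cvx; case: ccg. Qed.
Let cvxh : cvx h.
Proof. by case: PB => _ _ [[_ ch] _] _ _; exact: convex_function_cvx. Qed.
Let Lx0 : 0 < Lx. Proof. by case: PB => _ _ _ []. Qed.
Let Ly0 : 0 < Ly. Proof. by case: PB => _ _ _ []. Qed.
Let HLx : forall x1 x2 y, M x1 -> M x2 -> S y ->
  enorm (grad_x f x1 y - grad_x f x2 y) <= Lx * enorm (x1 - x2).
Proof. by case: PB => _ _ _ []. Qed.
Let HLy : forall x1 x2 y1 y2, M x1 -> M x2 -> S y1 -> S y2 ->
  enorm (grad_y f x1 y1 - grad_y f x2 y2) ^+ 2 <=
  Ly ^+ 2 * (enorm (x1 - x2) ^+ 2 + enorm (y1 - y2) ^+ 2).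
Proof. by case: PB => _ _ _ []. Qed.
Let HLh x1 x2 : `|h x1 - h x2| <= Lh * enorm (x1 - x2).
Proof. by case: PB. Qed.

Lemma enorm_le_sigma y : S y -> enorm y <= sigma_y S.
Proof.
move=> Sy; apply: (@ub_le_sup _ [set enorm y | y in S]); last by exists y.
have [m _ Hm] := enorm_bounded cS.
by exists m => _ [z Sz <-]; exact: Hm.
Qed.

Lemma sigma_ge0 : 0 <= sigma_y S.
Proof. by have [y Sy] := S0; exact: le_trans (enorm_ge0 y) (enorm_le_sigma Sy). Qed.

Section Regularized.
Variables (gam r : R) (yc : 'rV[R]_n2).
Let reg := regularized f g gam r yc.
Let ybar := ybar S f g gam r yc.

(** A maximizer exists, so the choice in [argmax] does not fall back on its default value. *)
Lemma ybarP x : S (ybar x) /\ forall z, S z -> reg x z <= reg x (ybar x).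
Proof.
pose phi y := f x y - gam / 2 * enorm (y - 0) ^+ 2 - r / 2 * enorm (y - yc) ^+ 2.
have cphi : continuous phi.
  move=> y.
  have quad c (a : 'rV[R]_n2) :
      {for y, continuous (fun z : 'rV[R]_n2 => c * enorm (z - a) ^+ 2)}.
    by apply: continuousM; [exact: cst_continuous|exact: enorm_sqr_continuous].
  apply: (continuousB (continuousB _ (quad _ _)) (quad _ _)).
  by apply: differentiable_continuous; exact: differentiable_fy.
have [y Sy Hy] := sub_closed_convex_attains_max cS S0 cphi ccg.
have : is_argmax S (reg x) y.
  split=> // w Sw; have := Hy w Sw.
  rewrite /phi /reg /regularized !subr0; lra.
by move=> H; rewrite /ybar /Defs.ybar /argmax; case: (xgetPex 0 (ex_intro _ y H)).
Qed.

Lemma Phi_ybar x : Phi S f g gam r yc x = reg x (ybar x).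
Proof.
have [Sy Hy] := ybarP x; apply/eqP; rewrite eq_le; apply/andP; split.
  apply: ge_sup; first by exists (reg x (ybar x)), (ybar x).
  by move=> _ [z Sz <-]; exact: Hy.
apply: (@ub_le_sup _ [set reg x y | y in S]); last by exists (ybar x).
by exists (reg x (ybar x)) => _ [z Sz <-]; exact: Hy.
Qed.

Lemma regularized_concave x a b t : 0 <= t <= 1 ->
  (1 - t) * reg x a + t * reg x b
  + (gam + r) / 2 * (t * (1 - t)) * enorm (b - a) ^+ 2
  <= reg x ((1 - t) *: a + t *: b).
Proof.
move=> t01.
have t01' : 0 <= 1 - t <= 1 by move: t01 => /andP[? ?]; apply/andP; split; lra.
have := cvxf x a b t01'; have := cvxg a b t01'.
rewrite (_ : 1 - (1 - t) = t); last by ring.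
rewrite /reg /regularized.
have -> : (1 - t) *: a + t *: b - yc = (1 - t) *: (a - yc) + t *: (b - yc).
  by apply/rowP => i; rewrite !mxE; ring.
rewrite !sqr_enorm_conv (_ : b - yc - (a - yc) = b - a); last first.
  by rewrite opprB addrA subrK.
lra.
Qed.

(** The two quadratic terms make the dual objective strongly concave with modulus gam + r, which
    gives quadratic growth at the maximizer. *)
Lemma ybar_strong x z : S z ->
  reg x z + (gam + r) / 2 * enorm (z - ybar x) ^+ 2 <= reg x (ybar x).
Proof.
move=> Sz; have [Sy Hy] := ybarP x.
have : - reg x (ybar x) + (gam + r) / 2 * enorm (z - ybar x) ^+ 2 <= - reg x z.
  apply: (@strong_convex_min _ _ (fun z => - reg x z)) => t /andP[t0 t1].
    have := @regularized_concave x (ybar x) z t; rewrite (ltW t0) t1 => /(_ isT).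
    lra.
  rewrite lerN2; apply: Hy; have := @convS z (ybar x) t Sz Sy.
  by rewrite addrC (ltW t0) t1 => /(_ isT).
lra.
Qed.

(** Optimality of [ybar] puts the gradient [e] of the two regularization terms into the set, and |e|
    is bounded through [sigma_y]. *)
Lemma dist0_ybar x : 0 < gam -> 0 < r -> S yc ->
  dist0 [set w | exists p q, [/\ subdifferential g (ybar x) p,
     normal_cone S (ybar x) q & w = grad_y f x (ybar x) - p - q]]
  <= (gam + 2 * r) * sigma_y S.
Proof.
move=> g0 r0 Syc; have [Sy Hy] := ybarP x; set yb := ybar x in Sy Hy *.
pose e := gam *: yb + r *: (yb - yc).
have [s [sg sN]] : exists s, subdifferential g yb s /\
    normal_cone S yb (grad_y f x yb - e - s).
  apply: subdifferential_sum_rule => // z Sz.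
  have dphi : is_derive (0 : R) (1 : R) (fun t => f x (yb + t *: (z - yb)) : R^o)
      (dot (grad_y f x yb) (z - yb)).
    have := is_derive_fy C1f x (is_derive_line yb (z - yb) 0).
    by rewrite scale0r addr0.
  (* Convexity of g and the expanded squares bound the increment of f along the segment by a linear
     term plus t^2, which yields the linearized optimality condition. *)
  have H := @is_derive_le R _ _ (g z - g yb + dot e (z - yb))
    ((gam + r) / 2 * enorm (z - yb) ^+ 2) dphi.
  have {}H : dot (grad_y f x yb) (z - yb) <= g z - g yb + dot e (z - yb).
    apply: H => t /andP[t0 t1]; rewrite scale0r addr0.
    have t01 : 0 <= t <= 1 by rewrite (ltW t0).
    have E : t *: z + (1 - t) *: yb = yb + t *: (z - yb).
      by apply/rowP => i; rewrite !mxE; ring.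
    have := cvxg z yb t01.
    have := Hy _ (convS Sz Sy t01); rewrite E.
    rewrite /reg /regularized.
    have -> : yb + t *: (z - yb) - yc = (yb - yc) + t *: (z - yb) by rewrite addrAC.
    rewrite (enorm_sqrD yb) (enorm_sqrD (yb - yc)) enormZp ?(ltW t0)// !dotZr.
    rewrite /e (dotDl (gam *: yb)) !(dotZl, exprMn); lra.
  move: H; rewrite !dotBl !dotBr; lra.
have ew : enorm e <= (gam + 2 * r) * sigma_y S.
  rewrite /e (le_trans (enormD _ _))// !enormZp ?(ltW g0) ?(ltW r0)//.
  have := enormB yb yc; have := enorm_le_sigma Sy; have := enorm_le_sigma Syc.
  move=> H1 H2 H3.
  have := ler_wpM2l (ltW g0) H2.
  have /(ler_wpM2l (ltW r0)) : enorm (yb - yc) <= 2 * sigma_y S by lra.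
  lra.
rewrite (le_trans _ ew)//; apply: ge_inf.
  by exists 0 => _ [w _ <-]; exact: enorm_ge0.
exists e => //; exists s, (grad_y f x yb - e - s); split=> //.
by apply/rowP => i; rewrite !mxE; ring.
Qed.

End Regularized.

(** On a singleton the minimality hypothesis of the sum rule is trivial, so it applies to the full
    gradient and 0 lies in the set. *)
Lemma dist0_singleton x y : S y -> (forall z, S z -> z = y) ->
  dist0 [set w | exists p q, [/\ subdifferential g y p,
     normal_cone S y q & w = grad_y f x y - p - q]] <= 0.
Proof.
move=> Sy Sy1.
have [s [sg sN]] : exists s, subdifferential g y s /\
    normal_cone S y (grad_y f x y - s).
  by apply: subdifferential_sum_rule => // z /Sy1 ->.
apply: ge_inf; first by exists 0 => _ [w _ <-]; exact: enorm_ge0.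
exists 0; last exact: enorm0.
by exists s, (grad_y f x y - s); split=> //; rewrite subrr.
Qed.

(* Comparing the two optimality conditions, with strong concavity. *)
Lemma ybar_perturbation x gam r yc gam' r' :
  let y := ybar S f g gam r yc x in
  let y' := ybar S f g gam' r' y x in
  S yc -> 0 < gam' -> gam' <= gam -> 0 < r -> 0 < r' ->
  gam' * enorm (y' - y) <= (gam - gam' + 2 * r) * sigma_y S.
Proof.
move=> y y' Syc g'0 gg r0 r'0.
have [Sy _] := ybarP gam r yc x; have [Sy' _] := ybarP gam' r' y x.
(* Each maximizer is tested in the growth inequality of the other problem; f and g cancel on adding.
   The second proximal term is centred at y itself. *)
have H1 := ybar_strong gam r yc x Sy'; have H2 := ybar_strong gam' r' y x Sy.
rewrite -/y -/y' in Sy Sy' H1 H2; clearbody y'; clearbody y.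
move: H1 H2; rewrite /regularized subrr enorm0 expr0n/= mulr0 (enormBC y y').
set d := enorm (y' - y) => H1 H2.
have d0 : 0 <= d := enorm_ge0 _.
have diff (p : 'rV[R]_n2) (c : R) : enorm (y' - p) <= c -> enorm (y - p) <= c ->
    enorm (y' - p) ^+ 2 - enorm (y - p) ^+ 2 <= 2 * c * d.
  move=> a1 a2.
  have : enorm (y' - p) <= enorm (y - p) + d.
    have := enormD (y - p) (y' - y).
    by rewrite (addrC (y - p)) addrA subrK addrC.
  by move=> H3; apply: ler_sqrB; rewrite ?enorm_ge0.
have s0 := sigma_ge0; set s := sigma_y S in s0 *.
have y's : enorm y' <= s := enorm_le_sigma Sy'.
have ys : enorm y <= s := enorm_le_sigma Sy.
have ycs : enorm yc <= s := enorm_le_sigma Syc.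
have D1 : enorm y' ^+ 2 - enorm y ^+ 2 <= 2 * s * d.
  by have := diff 0 s; rewrite !subr0; exact.
have D2 : enorm (y' - yc) ^+ 2 - enorm (y - yc) ^+ 2 <= 2 * (2 * s) * d.
  by apply: diff; rewrite mulr_natl mulr2n (le_trans (enormB _ _))// lerD.
have gg' : 0 <= gam - gam' by rewrite subr_ge0.
have D3 := ler_wpM2l gg' D1; have D4 := ler_wpM2l (ltW r0) D2.
have : gam' * d ^+ 2 <= (gam - gam' + 2 * r) * s * d.
  have P1 : 0 <= (gam - gam') * d ^+ 2 by rewrite mulr_ge0 ?sqr_ge0.
  have P2 : 0 <= r * d ^+ 2 by rewrite mulr_ge0 ?sqr_ge0// ltW.
  have P3 : 0 <= r' * d ^+ 2 by rewrite mulr_ge0 ?sqr_ge0// ltW.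
  lra.
have [->|dn0] := eqVneq d 0.
  by move=> _; rewrite mulr0 mulr_ge0// addr_ge0// mulr_ge0// ltW.
by rewrite expr2 mulrA ler_pM2r// lt_neqAle eq_sym dn0.
Qed.

(** * Stability of the prox step and descent along the retraction *)

Section Descent.
Variable (retr : 'rV[R]_n1 -> 'rV[R]_n1 -> 'rV[R]_n1).
Hypothesis retrM : retraction M retr.

(** The directional derivative is taken along the retraction curve, where the mixed difference bound
    applies because the curve stays in M. Hence the restriction to tangent directions. *)
Lemma grad_x_tangential x y y' tau : M x -> S y -> S y' -> tangent_space M x tau ->
  dot (grad_x f x y - grad_x f x y') tau <= Ly * enorm (y - y') * enorm tau.
Proof.
move=> Mx Sy Sy' Tt.
have [K K0 HK] := retraction_bounds retrM cM.
have [_ _ R0 RD] := retrM.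
pose c (t : R) := retr x (t *: tau).
have c0 : c 0 = x by rewrite /c scale0r R0.
have dphi : is_derive (0 : R) (1 : R) (fun t => f (c t) y - f (c t) y' : R^o)
    (dot (grad_x f x y - grad_x f x y') tau).
  rewrite dotBl -[in X in _ - X]c0 -[in X in X - _]c0.
  by apply: is_deriveB; apply: is_derive_fx => //; exact: RD.
apply: (is_derive_le (c := Ly * enorm (y - y') * K * enorm tau ^+ 2) dphi).
move=> t /andP[t0 t1]; rewrite c0.
have Tt' := tangent_spaceZ t Tt.
have Mc : M (c t) := retraction_in retrM Mx Tt'.
have := f_cross_difference C1f convS Ly0 HLy Mx Mc Sy' Sy.
have : enorm (c t - x) <= t * enorm tau + K * (t * enorm tau) ^+ 2.
  have := HK x _ Mx Tt'; have := enormD (c t - x - t *: tau) (t *: tau).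
  rewrite subrK enormZp ?(ltW t0)//; lra.
have Ld : 0 <= Ly * enorm (y - y') by rewrite mulr_ge0 ?enorm_ge0// ltW.
move/(ler_wpM2l Ld); lra.
Qed.

(** Quadratic growth: the tangent space is linear and the subproblem is b-strongly convex on it. *)
Lemma prox_linear_decrease b x y v : is_argmin (tangent_space M x) (prox_linear f h b x y) v ->
  forall w, tangent_space M x w ->
  prox_linear f h b x y v + b / 2 * enorm (w - v) ^+ 2 <= prox_linear f h b x y w.
Proof.
move=> [Tv minv] w Tw; apply: strong_convex_min => t /andP[t0 t1]; last first.
  by apply: minv; apply: tangent_spaceD; exact: tangent_spaceZ.
have t01' : 0 <= 1 - t <= 1 by apply/andP; split; lra.
have := cvxh (x + v) (x + w) t01'.
rewrite (_ : 1 - (1 - t) = t); last by ring.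
have -> : (1 - t) *: (x + v) + t *: (x + w) = x + ((1 - t) *: v + t *: w).
  by apply/rowP => i; rewrite !mxE; ring.
rewrite /prox_linear sqr_enorm_conv dotDr !dotZr; lra.
Qed.

(** Adding the two growth inequalities cancels h and the quadratic terms and leaves the gradient
    difference against v' - v, a tangent vector. *)
Lemma prox_linear_lipschitz b x y y' v v' : 0 < b -> M x -> S y -> S y' ->
  is_argmin (tangent_space M x) (prox_linear f h b x y) v ->
  is_argmin (tangent_space M x) (prox_linear f h b x y') v' ->
  b * enorm (v - v') <= Ly * enorm (y - y').
Proof.
move=> b0 Mx Sy Sy' Hv Hv'.
have [Tv _] := Hv; have [Tv' _] := Hv'.
have := prox_linear_decrease Hv Tv'; have := prox_linear_decrease Hv' Tv.
rewrite /prox_linear (enormBC v' v) => H1 H2.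
have Tvv : tangent_space M x (v' - v).
  by apply: tangent_spaceD => //; rewrite -scaleN1r; exact: tangent_spaceZ.
have := grad_x_tangential Mx Sy Sy' Tvv.
rewrite dotBl !dotBr (enormBC v' v) => H3.
set d := enorm (v - v') in H1 H2 H3 *.
have : b * d ^+ 2 <= Ly * enorm (y - y') * d by lra.
have [->|dn0] := eqVneq d 0.
  by move=> _; rewrite mulr0 mulr_ge0 ?enorm_ge0// ltW.
by rewrite expr2 mulrA ler_pM2r// lt_neqAle eq_sym dn0 enorm_ge0.
Qed.

Lemma retraction_descent : exists K1 K2, [/\ 0 < K1, 0 < K2 &
  forall gam r yc x b v a, 0 < gam -> 0 < r -> M x -> 0 <= a <= 1 ->
  is_argmin (tangent_space M x) (prox_linear f h b x (ybar S f g gam r yc x)) v ->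
  Q S f h g gam r yc (retr x (a *: v)) <= Q S f h g gam r yc x
    - a * b * enorm v ^+ 2 + a ^+ 2 * (K1 + K2 / (gam + r)) * enorm v ^+ 2].
Proof.
have [K K0 HK] := retraction_bounds retrM cM.
have [L L0 HL] := retraction_lipschitz retrM cM.
have [K' K'0 HK'] := f_retraction_upper C1f cM cS retrM Lx0 HLx.
exists (K' + `|Lh| * K + 1), (Ly ^+ 2 * L ^+ 2).
have K1 : 0 < K' + `|Lh| * K by rewrite ltr_wpDr// mulr_ge0// ltW.
have K2 : 0 < Ly ^+ 2 * L ^+ 2 by rewrite mulr_gt0// exprn_gt0.
split=> //; first by rewrite addr_gt0.
move=> gam r yc x b v a g0 r0 Mx /andP[a0 a1] Hv.
have [Tv _] := Hv; have Tu := tangent_spaceZ a Tv.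
set u := a *: v in Tu *; set x' := retr x u.
have Mx' : M x' := retraction_in retrM Mx Tu.
rewrite /Q !Phi_ybar; set y := ybar S f g gam r yc x in Hv *.
set y' := ybar S f g gam r yc x'.
have [Sy _] := ybarP gam r yc x; have [Sy' _] := ybarP gam r yc x'.
rewrite -/y -/y' in Sy Sy'.
have mu0 : 0 < gam + r by rewrite addr_gt0.
(* Testing y' at x bounds the increase of Phi by f(x', y') - f(x, y') - (gam + r)/2 |y' - y|^2; [H2]
   then exchanges y' for y in the f terms. *)
have H1 := ybar_strong gam r yc x Sy'; rewrite -/y in H1.
have H2 := f_cross_difference C1f convS Ly0 HLy Mx Mx' Sy Sy'.
have H3 := HK' x u y Mx Tu Sy; rewrite -/x' in H3.
have H4 : h x' <= h (x + u) + `|Lh| * K * enorm u ^+ 2.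
  have := HLh x' (x + u); rewrite ler_norml => /andP[_].
  have := HK x u Mx Tu; rewrite -/x' opprD addrA => H.
  have := ler_wpM2l (normr_ge0 Lh) H.
  have := ler_wpM2r (enorm_ge0 (x' - x - u)) (ler_norm Lh).
  lra.
have H5 : h (x + u) <= (1 - a) * h x + a * h (x + v).
  have a01 : 0 <= a <= 1 by rewrite a0.
  have := cvxh (x + v) x a01.
  have -> : a *: (x + v) + (1 - a) *: x = x + u.
    by apply/rowP => i; rewrite !mxE; ring.
  lra.
(* Comparison with w = 0: the prox term and the growth term add up to the full b |v|^2. *)
have H6 := prox_linear_decrease Hv (@tangent_space0 _ _ M x).
rewrite /prox_linear sub0r enormN enorm0 dot0r addr0 expr0n /= mulr0 addr0 in H6.
(* Completing the square in |y' - y|: the strong concavity gain absorbs the mixed term at a cost of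
   order 1/(gam + r). *)
have H7 : Ly * enorm (x' - x) * enorm (y' - y) - (gam + r) / 2 * enorm (y' - y) ^+ 2
    <= Ly ^+ 2 * L ^+ 2 / (gam + r) * enorm u ^+ 2.
  set p := enorm (x' - x); set d := enorm (y' - y).
  have pL : p <= L * enorm u := HL x u Mx Tu.
  have : p ^+ 2 <= (L * enorm u) ^+ 2.
    by rewrite ler_sqr ?nnegrE ?enorm_ge0// (le_trans (enorm_ge0 _) pL).
  have c0 : 0 <= Ly ^+ 2 / (gam + r) by rewrite divr_ge0 ?sqr_ge0// ltW.
  move=> /(ler_wpM2l c0).
  have : 0 <= (gam + r) / 2 * (d - Ly * p / (gam + r)) ^+ 2.
    by rewrite mulr_ge0 ?sqr_ge0// divr_ge0// ltW.
  have -> : (gam + r) / 2 * (d - Ly * p / (gam + r)) ^+ 2 =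
    (gam + r) / 2 * d ^+ 2 - Ly * p * d + Ly ^+ 2 / (gam + r) * p ^+ 2 / 2.
    by field; rewrite gt_eqF.
  have : 0 <= Ly ^+ 2 / (gam + r) * p ^+ 2 by rewrite mulr_ge0 ?sqr_ge0.
  have -> : Ly ^+ 2 * L ^+ 2 / (gam + r) * enorm u ^+ 2 = Ly ^+ 2 / (gam + r) * (L * enorm u) ^+ 2.
    by field; rewrite gt_eqF.
  lra.
have H8 := ler_wpM2l a0 H6.
have uE : enorm u ^+ 2 = a ^+ 2 * enorm v ^+ 2 by rewrite enormZp// exprMn.
have dE : dot (grad_x f x y) u = a * dot (grad_x f x y) v by rewrite dotZr.
have pos : 0 <= a ^+ 2 * enorm v ^+ 2 by rewrite mulr_ge0 ?sqr_ge0.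
rewrite uE in H3 H4 H7; rewrite dE in H3.
rewrite /regularized in H1 *.
lra.
Qed.

End Descent.
End DualProblem.

(** * Rates *)

Section CubeRoot.
Context {R : realType}.

Definition cbrt (k : nat) : R := k%:R `^ (3%:R^-1).

Lemma cbrt_ge0 k : 0 <= cbrt k. Proof. exact: powR_ge0. Qed.

Lemma cbrt3 k : cbrt k ^+ 3 = k%:R.
Proof. by rewrite -powR_mulrn ?cbrt_ge0// -powRrM mulVf ?powRr1. Qed.

Lemma cbrt_gt0 k : (0 < k)%N -> 0 < cbrt k.
Proof. by move=> k0; rewrite powR_gt0// ltr0n. Qed.

Lemma cbrt_le a k : 0 <= a -> (cbrt k <= a) = (k%:R <= a ^+ 3).
Proof. by move=> a0; rewrite -cbrt3 ler_pXn2r// ?nnegrE ?cbrt_ge0. Qed.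

Lemma cbrt_ge a k : 0 <= a -> (a <= cbrt k) = (a ^+ 3 <= k%:R).
Proof. by move=> a0; rewrite -cbrt3 ler_pXn2r// ?nnegrE ?cbrt_ge0. Qed.

Lemma cbrt_mono k m : (k <= m)%N -> cbrt k <= cbrt m.
Proof. by move=> km; rewrite cbrt_le ?cbrt_ge0// cbrt3 ler_nat. Qed.

Lemma cbrt_ge1 k : (0 < k)%N -> 1 <= cbrt k.
Proof. by move=> k0; rewrite cbrt_ge// expr1n ler1n. Qed.

Lemma cbrtS_le k : cbrt k.+1 <= cbrt k + 1.
Proof.
have c0 := cbrt_ge0 k.
rewrite cbrt_le ?addr_ge0// -natr1 -cbrt3.
have : 0 <= cbrt k ^+ 2 by rewrite sqr_ge0.
have -> : (cbrt k + 1) ^+ 3 = cbrt k ^+ 3 + 3 * cbrt k ^+ 2 + 3 * cbrt k + 1 by ring.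
lra.
Qed.

Lemma cbrtS_le2 k : (0 < k)%N -> cbrt k.+1 <= 2 * cbrt k.
Proof. by move=> /cbrt_ge1; have := cbrtS_le k; lra. Qed.

Lemma cbrt_double k : cbrt k.*2 <= 2 * cbrt k.
Proof.
rewrite cbrt_le ?mulr_ge0 ?cbrt_ge0// exprMn cbrt3 -muln2 natrM mulrC.
by rewrite ler_wpM2r// -natrX ler_nat.
Qed.

(* Among the indices of the window [K, 2K) with K ~ (b / eps)^3, the error term
   D / k^(1/3) is below eps / 2, and the weighted sum bounds some a k by eps / 2. *)
Lemma weighted_sum_rate (G a : nat -> R) (D V : R) : 0 <= V ->
  (forall k, (0 < k)%N -> G k <= a k + D / cbrt k) ->
  (forall k, 0 <= a k) ->
  (forall K, \sum_(1 <= k < K) a k ^+ 2 / cbrt k <= V) ->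
  exists2 B, 0 < B & forall eps, 0 < eps ->
    exists2 T, G T < eps & T%:R <= B / eps ^+ 3 + 2.
Proof.
(* The part 2|D| makes the error at most eps / 2 on the window; 8V is what the final count has to
   exceed. *)
move=> V0 HG a0 HV; pose b := 2 * `|D| + 8 * V + 1.
have D0 := normr_ge0 D.
have b1 : 1 <= b by rewrite /b; lra.
have b0 : 0 < b by lra.
exists (2 * b ^+ 3); first by rewrite mulr_gt0// exprn_gt0.
move=> eps e0.
have be0 : 0 < b / eps by rewrite divr_gt0.
(* The successor makes the cube root of K strictly larger than b / eps, and is the source of the
   additive 2 in the bound for 2K. *)
pose K := (Num.truncn ((b / eps) ^+ 3)).+1.
have be30 : 0 <= (b / eps) ^+ 3 by rewrite exprn_ge0// ltW.
have HK : b / eps < cbrt K.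
  rewrite ltNge cbrt_le ?(ltW be0)// -ltNge.
  by have /andP[] := truncn_itv be30.
have K2 : K.*2%:R <= 2 * b ^+ 3 / eps ^+ 3 + 2.
  have : (Num.truncn ((b / eps) ^+ 3))%:R <= (b / eps) ^+ 3.
    by have /andP[] := truncn_itv be30.
  rewrite -muln2 natrM /K -natr1 expr_div_n; lra.
have cK0 : 0 < cbrt K by rewrite cbrt_gt0.
have [[T [TK GT]]|nT] := pselect (exists T, (T < K.*2)%N /\ G T < eps).
  by exists T => //; rewrite (le_trans _ K2)// ler_nat ltnW.
exfalso.
have HGe k : (k < K.*2)%N -> eps <= G k.
  by move=> kK; rewrite leNgt; apply/negP => Gk; apply: nT; exists k.
have ak k : (K <= k < K.*2)%N -> eps / 2 <= a k.
  move=> /andP[Kk kK]; have k0 : (0 < k)%N by exact: leq_trans Kk.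
  have ck := lt_le_trans HK (cbrt_mono Kk).
  have c0 : 0 < cbrt k := cbrt_gt0 k0.
  have : D / cbrt k <= eps / 2.
    rewrite ler_pdivrMr//.
    have : b <= eps * cbrt k by rewrite mulrC -ler_pdivrMr// ltW.
    have := ler_norm D; rewrite /b; lra.
  have := HGe k kK; have := HG k k0; lra.
have := HV K.*2.
rewrite (big_cat_nat (n := K))//=; last by rewrite -addnn leq_addr.
have P1 : 0 <= \sum_(1 <= k < K) a k ^+ 2 / cbrt k.
  by apply: sumr_ge0 => k _; rewrite divr_ge0 ?sqr_ge0 ?cbrt_ge0.
(* If no index were good, each of the K terms would be at least (eps/2)^2 / (2 K^(1/3)), and the
   total (eps K^(1/3))^2 / 8 would exceed V. *)
have P2 : K%:R * ((eps / 2) ^+ 2 / (2 * cbrt K)) <= \sum_(K <= k < K.*2) a k ^+ 2 / cbrt k.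
  have -> : K%:R * ((eps / 2) ^+ 2 / (2 * cbrt K)) =
      \sum_(K <= k < K.*2) (eps / 2) ^+ 2 / (2 * cbrt K).
    by rewrite sumr_const_nat -addnn addnK mulr_natl.
  apply: ler_sum_nat => k kK; have /andP[Kk kK2] := kK.
  have k0 : (0 < k)%N by exact: leq_trans Kk.
  apply: ler_pM; rewrite ?sqr_ge0 ?invr_ge0 ?mulr_ge0 ?(ltW cK0)//.
    by rewrite ler_sqr ?nnegrE ?a0 ?ak// divr_ge0// ltW.
  rewrite lef_pV2 ?posrE ?mulr_gt0 ?cbrt_gt0//.
  by rewrite (le_trans (cbrt_mono (ltnW kK2)))// cbrt_double.
have P3 : K%:R * ((eps / 2) ^+ 2 / (2 * cbrt K)) = (eps * cbrt K) ^+ 2 / 8.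
  by rewrite -(cbrt3 K); field; rewrite gt_eqF.
have P4 : b < eps * cbrt K by rewrite mulrC -ltr_pdivrMr.
have P5 : b ^+ 2 < (eps * cbrt K) ^+ 2.
  by rewrite ltr_pXn2r ?nnegrE// ltW// (lt_trans b0).
have P6 : b <= b ^+ 2 by rewrite expr2 ler_peMl// ltW.
rewrite P3 in P2; have : 8 * V < b by rewrite /b; lra.
lra.
Qed.

End CubeRoot.

Lemma exists_min_nat (P : nat -> Prop) n : P n ->
  exists m, [/\ P m, forall k, (k < m)%N -> ~ P k & (m <= n)%N].
Proof.
move=> Pn; have ex : exists n, `[< P n >] by exists n; exact/asboolP.
case: (ex_minnP ex) => m /asboolP Pm minm; exists m; split=> //.
  by move=> k km Pk; have := minm k; rewrite leqNgt km => /(_ (asboolT Pk)).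
by apply: minm; exact/asboolP.
Qed.

(** With e <= abar/(4 c1) the squared denominator is at most (3/4) gamma0 abar, so the quotient
    grows like abar^(-1/2). *)
Lemma sqrt_ratio_ge {R : realType} (N lmax c1 e gamma0 abar B : R) :
  0 < N -> 0 < lmax -> 0 < c1 -> 0 < e -> 0 < gamma0 ->
  0 < abar <= 2 * N * lmax / (gamma0 * (B ^+ 2 + 1)) -> e <= abar / (4 * c1) ->
  B <= Num.sqrt (2 * N * lmax) / Num.sqrt (3 * c1 * e * gamma0).
Proof.
move=> N0 lmax0 c10 e0 gamma00 /andP[ab0 able] He.
have Y0 : 0 < 3 * c1 * e * gamma0 by rewrite !mulr_gt0.
have X0 : 0 <= 2 * N * lmax by rewrite !mulr_ge0// ltW.
rewrite ler_pdivlMr ?sqrtr_gt0//.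
apply: (@le_trans _ _ (`|B| * Num.sqrt (3 * c1 * e * gamma0))).
  by rewrite ler_wpM2r ?sqrtr_ge0// ler_norm.
rewrite -sqrtr_sqr -sqrtrM ?sqr_ge0// ler_sqrt//.
have E1 : 3 * c1 * e * gamma0 <= gamma0 * abar.
  have P : 0 <= 3 * c1 * gamma0 by rewrite !mulr_ge0// ltW.
  have := ler_wpM2l P He.
  have -> : 3 * c1 * gamma0 * (abar / (4 * c1)) = 3 / 4 * (gamma0 * abar).
    by field; rewrite gt_eqF.
  have : 0 < gamma0 * abar by rewrite mulr_gt0.
  lra.
have B20 := sqr_ge0 B.
have B1 : 0 < gamma0 * (B ^+ 2 + 1) by rewrite mulr_gt0// ltr_wpDl.
move: able; rewrite ler_pdivlMr// => able.
have := ler_wpM2l B20 E1.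
have : 0 < gamma0 * abar by rewrite mulr_gt0.
lra.
Qed.

(** With d = B + 1 >= 1, one has m >= c + d and (c + d)^3 >= c^3 + d^3 >= c^3 + B. It serves to
    absorb the surplus unit of the rate into the constant. *)
Lemma cube_ge {R : realType} (B c m : R) : 0 <= B -> 0 <= c ->
  2 * c + B + 1 <= m -> B + c ^+ 3 <= m ^+ 3.
Proof.
move=> B0 c0 Hm; set d := B + 1.
have d1 : 1 <= d by rewrite lerDr.
have d0 : 0 <= d := le_trans ler01 d1.
have : (c + d) ^+ 3 <= m ^+ 3.
  by rewrite ler_pXn2r ?nnegrE ?addr_ge0//; rewrite /d in d0 *; lra.
have -> : (c + d) ^+ 3 = c ^+ 3 + 3 * (c ^+ 2 * d) + 3 * (c * d ^+ 2) + d ^+ 3 by ring.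
have : d <= d ^+ 3 by rewrite exprS ler_peMr// exprn_ege1.
have : 0 <= c ^+ 2 * d by rewrite mulr_ge0 ?sqr_ge0.
have : 0 <= c * d ^+ 2 by rewrite mulr_ge0 ?sqr_ge0.
rewrite /d; lra.
Qed.

(** * The algorithm *)

Section Run.
Context {R : realType} {n1 n2 : nat}.
Variables (M : set 'rV[R]_n1) (S : set 'rV[R]_n2).
Variables (f : 'rV[R]_n1 -> 'rV[R]_n2 -> R).
Variables (h : 'rV[R]_n1 -> R) (g : 'rV[R]_n2 -> R).
Variables (Lx Ly Lh : R).
Variable (retr : 'rV[R]_n1 -> 'rV[R]_n1 -> 'rV[R]_n1).
Variables (c1 eta gamma0 lmin lmax : R) (rho : nat -> R).
Variables (Tbar : nat) (T : nat -> nat).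
Variables (x0 : 'rV[R]_n1) (y0 : 'rV[R]_n2).
Variables (x : nat -> 'rV[R]_n1) (y : nat -> 'rV[R]_n2).
Variables (xi : nat -> nat -> 'rV[R]_n1) (l : nat -> nat -> R).
Variables (v : nat -> nat -> 'rV[R]_n1) (j : nat -> nat -> nat).
Hypothesis PB : minimax_problem M S f h g Lx Ly Lh.
Hypothesis retrM : retraction M retr.
Hypothesis params : mpgda_pa_params c1 eta gamma0 lmin lmax rho Tbar T.
Hypothesis run : mpgda_pa_run M S f h g retr c1 eta gamma0 lmin lmax rho T y x0 y0
    x xi l v j.

Local Notation gam := (gamma gamma0).
Local Notation sigma := (sigma_y S).
Local Notation b := (beta gamma0 rho l).
Local Notation Qk := (Defs.Qk S f h g gamma0 rho y).

Let c1_gt0 : 0 < c1. Proof. by case: params => [[/andP[]]]. Qed.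
Let c1_lt1 : c1 < 1. Proof. by case: params => [[/andP[]]]. Qed.
Let eta_gt0 : 0 < eta. Proof. by case: params => [[_ /andP[]]]. Qed.
Let eta_lt1 : eta < 1. Proof. by case: params => [[_ /andP[]]]. Qed.
Let gamma0_gt0 : 0 < gamma0. Proof. by case: params => [[]]. Qed.
Let lmin_gt0 : 0 < lmin. Proof. by case: params => [[_ _ _ /andP[]]]. Qed.
Let lmax_gt0 : 0 < lmax.
Proof. by case: params => [[_ _ _ /andP[? /(lt_trans _)->]]]. Qed.
Let rho_gt0 k : 0 < rho k. Proof. by case: params => _ []. Qed.
Let rho_mono : nonincreasing_seq rho. Proof. by case: params => _ []. Qed.
Let rho_sum : cvgn (series rho). Proof. by case: params => _ []. Qed.
Let T_gt0 k : (0 < T k)%N. Proof. by case: params => _ [_ _ _ /(_ k)/andP[]]. Qed.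
Let T_le k : (T k <= Tbar)%N. Proof. by case: params => _ [_ _ _ /(_ k)/andP[]]. Qed.

Let s_ge0 : 0 <= sigma := sigma_ge0 PB.
Let Mx0 : M x0. Proof. by case: run => [[]]. Qed.
Let Sy0 : S y0. Proof. by case: run => [[]]. Qed.
Let xi0 k : xi k 0%N = x k. Proof. by case: run. Qed.
Let step k i : (i < T k)%N ->
  [/\ lmin <= l k i <= lmax,
      is_argmin (tangent_space M (xi k i))
        (prox_linear f h (b k i) (xi k i) (ybark S f g gamma0 rho y k (xi k i))) (v k i),
      Qk k (retr (xi k i) (eta ^+ j k i *: v k i)) <=
        Qk k (xi k i) - c1 * eta ^+ j k i * b k i * enorm (v k i) ^+ 2
        + 2 * rho k * sigma ^+ 2,
      forall t, (t < j k i)%N -> ~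
        Qk k (retr (xi k i) (eta ^+ t *: v k i)) <=
        Qk k (xi k i) - c1 * eta ^+ t * b k i * enorm (v k i) ^+ 2
        + 2 * rho k * sigma ^+ 2
    & xi k i.+1 = retr (xi k i) (eta ^+ j k i *: v k i)].
Proof. by case: run => _ _ _ H _; exact: H. Qed.
Let xS k : x k.+1 = xi k (T k). Proof. by case: run => _ _ _ _ /(_ k)[]. Qed.
Let yS k : y k.+1 = ybark S f g gamma0 rho y k (x k.+1).
Proof. by case: run => _ _ _ _ /(_ k)[]. Qed.

(** * Feasibility of the iterates *)

Lemma xi_in k i : M (x k) -> (i <= T k)%N -> M (xi k i).
Proof.
move=> Mx; elim: i => [_|i IH iT]; first by rewrite xi0.
have [_ [Tv _] _ _ ->] := step iT.
by apply: (retraction_in retrM); [exact: IH (ltnW iT)|exact: tangent_spaceZ].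
Qed.

Lemma x_in k : M (x k).
Proof.
elim: k => [|k IH]; first by case: run => _ [->].
by rewrite xS; exact: xi_in.
Qed.

Lemma y_in k : S (y k).
Proof.
case: k => [|k]; first by case: run => _ [_ ->].
by rewrite yS; have [] := ybarP PB (gam k) (rho k) (y k) (x k.+1).
Qed.

(** * Decay of the regularization parameters *)

Lemma gammaE k : gam k.+1 = gamma0 / cbrt k.+1. Proof. by []. Qed.

Lemma gamma_gt0 k : 0 < gam k.
Proof. by case: k => [//|k]; rewrite gammaE divr_gt0// cbrt_gt0. Qed.

Lemma gammaS_le k : gam k.+1 <= gam k.
Proof.
case: k => [|k]; rewrite gammaE.
  by rewrite ler_pdivrMr ?cbrt_gt0// ler_peMr ?(ltW gamma0_gt0)// cbrt_ge1.
by rewrite ler_pM2l// lef_pV2 ?posrE ?cbrt_gt0// cbrt_mono.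
Qed.

Lemma gamma_le k : gam k <= gamma0.
Proof. by elim: k => // k; exact: le_trans (gammaS_le k). Qed.

(** With a, c the cube roots of k and k + 1, (1/a - 1/c) c^2 = (c - a)(c/a). The crude bounds c - a
    <= 1 and c/a <= 2 suffice: dividing by gamma afterwards still leaves k^(-1/3). *)
Lemma gamma_decrement k : (gam k - gam k.+1) * cbrt k.+1 ^+ 2 <= 2 * gamma0.
Proof.
(* gamma_0 = gamma_1, so the first decrement is 0. *)
case: k => [|k].
  rewrite gammaE /cbrt powR1 divr1 /gamma eqxx subrr mul0r mulr_ge0//.
  exact: ltW.
have a0 := @cbrt_gt0 R k.+1 isT; have c0 := @cbrt_gt0 R k.+2 isT.
have H1 := @cbrtS_le R k.+1; have H2 := @cbrtS_le2 R k.+1 isT.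
rewrite !gammaE; set a := cbrt k.+1 in a0 H1 H2 *; set c := cbrt k.+2 in c0 H1 H2 *.
have -> : (gamma0 / a - gamma0 / c) * c ^+ 2 = gamma0 * ((c - a) * (c / a)).
  by field; rewrite !gt_eqF.
rewrite mulrC ler_pM2r//.
have ca : 0 < c / a <= 2 by rewrite divr_gt0// ler_pdivrMr.
have [ca1 ca2] := andP ca.
have [n|p] := leP (c - a) 0.
  by rewrite (@le_trans _ _ 0)// mulr_le0_ge0// ltW.
rewrite -[2]mul1r ler_pM// ?(ltW p, ltW ca1)//; lra.
Qed.

Lemma gamma_le_cbrt k : gam k <= 2 * gamma0 / cbrt k.+1.
Proof.
case: k => [|k].
  by rewrite /cbrt powR1 divr1 /gamma eqxx; have := gamma0_gt0; lra.
rewrite gammaE ler_pdivlMr ?cbrt_gt0// mulrAC ler_pdivrMr ?cbrt_gt0//.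
by rewrite [leRHS]mulrAC [leRHS]mulrC ler_pM2l// cbrtS_le2.
Qed.

Let Srho := limn (series rho).

Lemma series_rho_le k : series rho k <= Srho.
Proof.
apply: nondecreasing_cvgn_le => //; apply/nondecreasing_seqP => m.
by rewrite !seriesEnat/= big_nat_recr//= lerDl ltW.
Qed.

(** By monotonicity the first k + 1 terms are all at least [rho k]. *)
Lemma rho_le_sum k : k.+1%:R * rho k <= Srho.
Proof.
apply: le_trans (series_rho_le k.+1).
have -> : k.+1%:R * rho k = \sum_(0 <= i < k.+1) rho k.
  by rewrite sumr_const_nat subn0 mulr_natl.
by rewrite seriesEnat/=; apply: ler_sum_nat => i /andP[_ ik]; exact: rho_mono.
Qed.

Lemma rho_cbrt k : rho k * cbrt k.+1 ^+ 2 <= Srho.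
Proof.
apply: le_trans (rho_le_sum k); rewrite mulrC ler_pM2r//.
rewrite -(cbrt3 k.+1) [leRHS]exprS ler_peMl ?sqr_ge0// cbrt_ge1//.
Qed.

Lemma Srho_ge0 : 0 <= Srho.
Proof. by apply: le_trans (series_rho_le 0); rewrite seriesEnat/= big_geq. Qed.

(** * Sufficient decrease and the line search *)

Lemma beta_gt0 k i : (i < T k)%N -> 0 < b k i.
Proof.
move=> iT; have [/andP[lk _] _ _ _ _] := step iT.
by rewrite divr_gt0 ?addr_gt0 ?gamma_gt0// (lt_le_trans lmin_gt0).
Qed.

(** beta and the error coefficient K1 + K2/mu both scale like 1/mu; after multiplication by mu the
    error is at most [kappa] for all k. The fraction [c] is free: c1 for the line search, 1/4 for
    the stated inequality, 1/2 in the degenerate case. *)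
Lemma sufficient_decrease : exists2 kappa, 0 < kappa &
  forall c a k z w lz, M z -> 0 <= a <= 1 -> a * kappa <= (1 - c) * lmin ->
    c <= 1 -> lmin <= lz ->
    is_argmin (tangent_space M z)
      (prox_linear f h (lz / (rho k + gam k)) z (ybark S f g gamma0 rho y k z)) w ->
    Qk k (retr z (a *: w)) <=
    Qk k z - c * a * (lz / (rho k + gam k)) * enorm w ^+ 2.
Proof.
have [K1 [K2 [K10 K20 H]]] := retraction_descent PB retrM.
have rg0 : 0 < rho 0%N + gamma0 by rewrite addr_gt0.
exists (K1 * (rho 0%N + gamma0) + K2); first by rewrite addr_gt0// mulr_gt0.
move=> c a k z w lz Mz a01 ac cle1 lzm Hw; have /andP[a0 a1] := a01.
have := H _ _ _ _ _ _ _ (gamma_gt0 k) (rho_gt0 k) Mz a01 Hw.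
rewrite -/(Defs.Qk S f h g gamma0 rho y k) (addrC (gam k)).
set mu := rho k + gam k.
have mu0 : 0 < mu by rewrite addr_gt0 ?gamma_gt0.
have mule : mu <= rho 0%N + gamma0 by rewrite lerD ?gamma_le// rho_mono.
have E0 := sqr_ge0 (enorm w).
suff : a ^+ 2 * (K1 + K2 / mu) * enorm w ^+ 2 <= (1 - c) * (a * (lz / mu) * enorm w ^+ 2).
  rewrite /Defs.Qk; lra.
rewrite (_ : (1 - c) * _ = a * ((1 - c) * lz) / mu * enorm w ^+ 2); last by ring.
rewrite ler_wpM2r//.
have -> : a ^+ 2 * (K1 + K2 / mu) = a * (a * (K1 * mu + K2)) / mu.
  by field; rewrite gt_eqF.
rewrite ler_pM2r ?invr_gt0// ler_wpM2l//.
have H1 : a * (K1 * mu + K2) <= a * (K1 * (rho 0%N + gamma0) + K2).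
  by rewrite ler_wpM2l// lerD2r ler_pM2l.
by rewrite (le_trans H1)// (le_trans ac)// ler_wpM2l// subr_ge0.
Qed.

Lemma line_search_bounded : exists t0, forall k i, (i < T k)%N -> (j k i <= t0)%N.
Proof.
have [kappa kappa0 H] := sufficient_decrease.
have d0 : 0 < (1 - c1) * lmin / kappa by rewrite divr_gt0// mulr_gt0// subr_gt0.
have [t0 Ht0] : exists t0, eta ^+ t0 <= (1 - c1) * lmin / kappa.
  have : eta ^+ n @[n --> \oo] --> 0 by apply: cvg_expr; rewrite gtr0_norm.
  move=> /cvgrPdist_lt/(_ _ d0)[t0 _ /(_ t0)/=]; rewrite leqnn => /(_ isT) Ht.
  exists t0; move: Ht; rewrite sub0r normrN gtr0_norm ?exprn_gt0//; exact: ltW.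
exists t0 => k i iT; rewrite leqNgt; apply/negP => tj.
have [/andP[lk _] Hv _ nacc _] := step iT.
(* The step eta^t0 already passes the acceptance test, against the minimality of j. *)
apply: (nacc _ tj).
have e01 : 0 <= eta ^+ t0 <= 1 by rewrite exprn_ge0 ?exprn_ile1 ?ltW.
have := H c1 (eta ^+ t0) k _ _ _ (xi_in (x_in k) (ltnW iT)) e01 _ (ltW c1_lt1) lk Hv.
rewrite -ler_pdivlMr// => /(_ Ht0).
have : 0 <= 2 * rho k * sigma ^+ 2 by rewrite !mulr_ge0 ?(ltW (rho_gt0 _)) ?s_ge0.
rewrite /beta; lra.
Qed.

(** * Bounds on the objective and telescoping of Q_k *)

Lemma objective_bounded : exists2 B, 0 < B & forall z w, M z -> S w ->
  `|objective f h g z w| <= B.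
Proof.
have [[cM _ cS _ _] [C1f _] [_ [_ /convex_function_cvx cvxg]] _ HLh] := PB.
have [Bf Bf0 Hf] := f_bounded C1f cM cS.
have [m m0 Hm] := enorm_bounded cM; have [s s0 Hs] := enorm_bounded cS.
have [c Hc] := cvx_bounded cvxg s.
exists (Bf + (`|h x0| + `|Lh| * (m + m)) + `|c|).
  by rewrite ltr_wpDr// ltr_wpDr// addr_ge0// mulr_ge0// addr_ge0// ltW.
move=> z w Mz Sw; rewrite (le_trans (ler_normB _ _))// lerD//; last first.
  by rewrite (le_trans (Hc w (Hs w Sw)))// ler_norm.
rewrite (le_trans (ler_normD _ _))// lerD ?Hf//.
have -> : h z = h x0 + (h z - h x0) by rewrite addrC subrK.
rewrite (le_trans (ler_normD _ _))// lerD// (le_trans (HLh _ _))//.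
rewrite (@le_trans _ _ (`|Lh| * enorm (z - x0)))//.
  by rewrite ler_wpM2r ?enorm_ge0// ler_norm.
by rewrite ler_wpM2l// (le_trans (enormB _ _))// lerD ?Hm.
Qed.

Lemma Q_ybar k z : Qk k z = objective f h g z (ybark S f g gamma0 rho y k z)
  - gam k / 2 * enorm (ybark S f g gamma0 rho y k z) ^+ 2
  - rho k / 2 * enorm (ybark S f g gamma0 rho y k z - y k) ^+ 2.
Proof.
rewrite /Defs.Qk /Q (Phi_ybar PB) /regularized /objective -/(ybark S f g gamma0 rho y k z).
ring.
Qed.

Lemma enorm_sqr_le_sigma w : S w -> enorm w ^+ 2 <= sigma ^+ 2.
Proof.
move=> Sw; rewrite ler_sqr ?nnegrE ?enorm_ge0 ?(sigma_ge0 PB)//.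
exact: (enorm_le_sigma PB).
Qed.

Lemma enorm_sqrB_le_sigma w w' : S w -> S w' -> enorm (w - w') ^+ 2 <= 4 * sigma ^+ 2.
Proof.
move=> Sw Sw'; have -> : 4 * sigma ^+ 2 = (2 * sigma) ^+ 2 by ring.
have s0 := sigma_ge0 PB.
rewrite ler_sqr ?nnegrE ?enorm_ge0 ?mulr_ge0// (le_trans (enormB _ _))//.
by have := enorm_le_sigma PB Sw; have := enorm_le_sigma PB Sw'; lra.
Qed.

Lemma Q_bounded_below : exists B, forall k z, M z -> - B <= Qk k z.
Proof.
have [B B0 HB] := objective_bounded.
exists (B + gamma0 / 2 * sigma ^+ 2 + rho 0%N / 2 * (4 * sigma ^+ 2)) => k z Mz.
rewrite Q_ybar; have [Sw _] := ybarP PB (gam k) (rho k) (y k) z.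
rewrite -/(ybark S f g gamma0 rho y k z) in Sw *.
set w := ybark _ _ _ _ _ _ _ _ in Sw *.
have := HB z w Mz Sw; rewrite ler_norml => /andP[H _].
have : gam k / 2 * enorm w ^+ 2 <= gamma0 / 2 * sigma ^+ 2.
  apply: ler_pM; rewrite ?sqr_ge0 ?divr_ge0 ?(ltW (gamma_gt0 k))//.
    by rewrite ler_pM2r ?invr_gt0// gamma_le.
  exact: enorm_sqr_le_sigma.
have : rho k / 2 * enorm (w - y k) ^+ 2 <= rho 0%N / 2 * (4 * sigma ^+ 2).
  apply: ler_pM; rewrite ?sqr_ge0 ?divr_ge0 ?(ltW (rho_gt0 k))//.
    by rewrite ler_pM2r ?invr_gt0// rho_mono.
  exact: enorm_sqrB_le_sigma (y_in k).
lra.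
Qed.

(** The maximizer of the new problem is a candidate in the old one. The smaller gamma costs at most
    its decrement times sigma^2 / 2, the old proximal term at most rho_k/2 times (2 sigma)^2. *)
Lemma Q_next k z : Qk k.+1 z <=
  Qk k z + (gam k - gam k.+1) / 2 * sigma ^+ 2 + 2 * rho k * sigma ^+ 2.
Proof.
rewrite (Q_ybar k.+1); have [Sw _] := ybarP PB (gam k.+1) (rho k.+1) (y k.+1) z.
rewrite -/(ybark S f g gamma0 rho y k.+1 z) in Sw *.
set w := ybark _ _ _ _ _ _ _ _ in Sw *.
have [_ /(_ w Sw)] := ybarP PB (gam k) (rho k) (y k) z.
rewrite -(Phi_ybar PB) /Defs.Qk /Q /regularized /objective => H.
have g0 : 0 <= (gam k - gam k.+1) / 2 by rewrite divr_ge0// subr_ge0 gammaS_le.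
have := ler_wpM2l g0 (enorm_sqr_le_sigma Sw).
have := ler_wpM2l (ltW (rho_gt0 k)) (enorm_sqrB_le_sigma Sw (y_in k)).
have : 0 <= rho k.+1 / 2 * enorm (w - y k.+1) ^+ 2.
  by rewrite mulr_ge0 ?sqr_ge0// divr_ge0// (ltW (rho_gt0 _)).
lra.
Qed.

(** Only the decrease of the first inner step is kept, since the stationarity measure refers to it;
    each step pays the slack 2 rho_k sigma^2. *)
Lemma inner_loop t0 k : (forall i, (i < T k)%N -> (j k i <= t0)%N) ->
  Qk k (x k.+1) <= Qk k (x k) - c1 * eta ^+ t0 * b k 0%N * enorm (v k 0%N) ^+ 2
    + 2 * Tbar%:R * rho k * sigma ^+ 2.
Proof.
move=> Hj; rewrite xS.
have P i : (i < T k)%N -> Qk k (xi k i.+1) <= Qk k (xi k i)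
    - c1 * eta ^+ t0 * b k i * enorm (v k i) ^+ 2 + 2 * rho k * sigma ^+ 2.
  move=> iT; have [_ _ acc _ ->] := step iT; rewrite (le_trans acc)// lerD2r lerD2l lerN2.
  rewrite !ler_wpM2r ?sqr_ge0 ?(ltW (beta_gt0 iT))// ler_wpM2l ?(ltW c1_gt0)//.
  by apply: ler_wiXn2l => //; [exact: ltW..|exact: Hj].
have s0 : 0 <= 2 * rho k * sigma ^+ 2 by rewrite !mulr_ge0 ?(ltW (rho_gt0 _)) ?s_ge0.
have P' i : (i.+1 <= T k)%N -> Qk k (xi k i.+1) <= Qk k (x k)
    - c1 * eta ^+ t0 * b k 0%N * enorm (v k 0%N) ^+ 2 + i.+1%:R * (2 * rho k * sigma ^+ 2).
  elim: i => [iT|i IH iT]; first by rewrite mul1r -xi0; exact: P.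
  have := P i.+1 iT; have := IH (ltnW iT); rewrite -[i.+2%:R]natr1.
  have : 0 <= c1 * eta ^+ t0 * b k i.+1 * enorm (v k i.+1) ^+ 2.
    have e0 : 0 <= eta ^+ t0 by rewrite exprn_ge0 ?(ltW eta_gt0).
    rewrite mulr_ge0 ?sqr_ge0// mulr_ge0 ?(ltW (beta_gt0 iT))// mulr_ge0//.
    exact: ltW.
  lra.
have := P' (T k).-1; rewrite prednK// => /(_ (leqnn _)).
have : (T k)%:R * (2 * rho k * sigma ^+ 2) <= Tbar%:R * (2 * rho k * sigma ^+ 2).
  by rewrite ler_wpM2r// ler_nat.
lra.
Qed.

Lemma summable_decrease : exists2 V, 0 <= V & forall K,
  \sum_(0 <= k < K) b k 0%N * enorm (v k 0%N) ^+ 2 <= V.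
Proof.
have [t0 Ht0] := line_search_bounded; have [B HB] := Q_bounded_below.
pose c := c1 * eta ^+ t0.
have c0 : 0 < c by rewrite mulr_gt0// exprn_gt0.
(* [Tbar] slacks come from the inner loop and one more from passing from Q_k to Q_{k+1}. *)
pose A := 2 * Tbar.+1%:R * sigma ^+ 2.
have A0 : 0 <= A by rewrite !mulr_ge0 ?s_ge0.
have P K : c * \sum_(0 <= k < K) b k 0%N * enorm (v k 0%N) ^+ 2 <=
   Qk 0 (x 0%N) - Qk K (x K) + (gamma0 - gam K) / 2 * sigma ^+ 2 + A * series rho K.
  elim: K => [|K IH]; first by rewrite seriesEnat/= !big_geq// mulr0 /gamma eqxx; lra.
  have H1 := inner_loop (fun i => @Ht0 K i); have H2 := Q_next K (x K.+1).
  rewrite -/c in H1.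
  have SE : series rho K.+1 = series rho K + rho K.
    by rewrite !seriesEnat/= big_nat_recr.
  rewrite SE big_nat_recr//= !mulrDr.
  move: IH H1 H2; rewrite /A -natr1.
  move: (Qk 0 _) (Qk K _) (Qk K _) (Qk K.+1 _) (series rho K) (\sum_(_ <= _ < _) _).
  move=> *; lra.
pose V := Qk 0 (x 0%N) + B + gamma0 / 2 * sigma ^+ 2 + A * Srho.
have PV K : c * \sum_(0 <= k < K) b k 0%N * enorm (v k 0%N) ^+ 2 <= V.
  rewrite (le_trans (P K))//.
  have := HB K _ (x_in K); have := ler_wpM2l A0 (series_rho_le K).
  have : 0 <= gam K / 2 * sigma ^+ 2.
    by rewrite mulr_ge0 ?sqr_ge0// divr_ge0// (ltW (gamma_gt0 K)).
  rewrite /V; lra.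
exists (V / c).
  by rewrite divr_ge0 ?(ltW c0)//; have := PV 0%N; rewrite big_geq// mulr0.
by move=> K; rewrite ler_pdivlMr// mulrC.
Qed.

(** * Rate for the stationarity measure *)

Let G k := stationarity M S f h g (b k 0%N) (x k) (y k).

(** The index starts at 1 because only y_{k+1} is known to be a regularized maximizer; y_0 is an
    arbitrary point of S. *)
Lemma stationarity_le : exists D, forall k,
  G k.+1 <= b k.+1 0%N * enorm (v k.+1 0%N) + D / cbrt k.+1.
Proof.
have Ly0 : 0 < Ly by case: PB => _ _ _ [].
have s0 := sigma_ge0 PB; have Sr0 := Srho_ge0.
have C0 : 0 <= (2 * gamma0 + 2 * Srho) * sigma by rewrite mulr_ge0// addr_ge0// mulr_ge0// ltW.
have D1 : 0 <= Ly / gamma0 * ((2 * gamma0 + 2 * Srho) * sigma) by rewrite mulr_ge0// divr_ge0// ltW.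
(* The first summand pays for the change of dual point in the prox step, the second for the dual
   distance. *)
pose D := Ly / gamma0 * ((2 * gamma0 + 2 * Srho) * sigma) + (2 * gamma0 + 2 * Srho) * sigma.
exists D => k.
have s1 := @cbrt_ge1 R k.+1 isT; have s00 := @cbrt_gt0 R k.+1 isT.
have bv0 : 0 <= b k.+1 0%N * enorm (v k.+1 0%N).
  by rewrite mulr_ge0 ?enorm_ge0// ltW// beta_gt0.
have Dk : 0 <= D / cbrt k.+1 by rewrite divr_ge0 ?(ltW s00)// addr_ge0.
have [] := step (T_gt0 k.+1); rewrite xi0 => lk Hv _ _ _.
rewrite /G /stationarity ge_max; apply/andP; split.
  rewrite /argmin; case: xgetP => [u _ Hu|_]; last first.
    by rewrite scaler0 enorm0 addr_ge0.
  have bk0 := beta_gt0 (T_gt0 k.+1).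
  have Sy := y_in k.+1.
  have [Sy' _] := ybarP PB (gam k.+1) (rho k.+1) (y k.+1) (x k.+1).
  rewrite -/(ybark S f g gamma0 rho y k.+1 (x k.+1)) in Sy'.
  have H := prox_linear_lipschitz PB retrM bk0 (x_in k.+1) Sy Sy' Hu Hv.
  rewrite enormZp ?(ltW bk0)//.
  have -> : u = v k.+1 0%N + (u - v k.+1 0%N) by rewrite addrC subrK.
  have := ler_wpM2l (ltW bk0) (enormD (v k.+1 0%N) (u - v k.+1 0%N)).
  move/le_trans; apply; rewrite mulrDr lerD2l (le_trans H)//.
  have := ybar_perturbation PB (x k.+1) (gam := gam k) (r' := rho k.+1)
    (y_in k) (gamma_gt0 k.+1) (gammaS_le k) (rho_gt0 k) (rho_gt0 k.+1).
  rewrite -/(ybark S f g gamma0 rho y k (x k.+1)) -yS.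
  rewrite -/(ybark S f g gamma0 rho y k.+1 (x k.+1)) enormBC.
  set d := enorm _; have d0 : 0 <= d := enorm_ge0 _; rewrite gammaE => Hd.
  have E1 := gamma_decrement k; have E2 := rho_cbrt k.
  set s := cbrt k.+1 in s1 s00 Dk Hd E1 E2 *.
  (* Multiplying by s^2 turns gamma0/s into gamma0 s on the left, while the decrement of gamma and
     rho_k absorb s^2 on the right. *)
  have {}Hd : gamma0 * d * s <= (2 * gamma0 + 2 * Srho) * sigma.
    have -> : gamma0 * d * s = gamma0 / s * d * s ^+ 2 by field; rewrite gt_eqF.
    have /le_trans := ler_wpM2r (sqr_ge0 s) Hd; apply.
    rewrite mulrAC ler_wpM2r//; rewrite -/(gam k.+1) gammaE -/s in E1.
    lra.
  rewrite ler_pdivlMr//.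
  have : Ly * d * s <= Ly / gamma0 * ((2 * gamma0 + 2 * Srho) * sigma).
    have -> : Ly * d * s = Ly / gamma0 * (gamma0 * d * s) by field; rewrite gt_eqF.
    by rewrite ler_wpM2l// divr_ge0// ltW.
  rewrite /D; lra.
have := dist0_ybar PB (x k.+1) (gamma_gt0 k) (rho_gt0 k) (y_in k).
rewrite -/(ybark S f g gamma0 rho y k (x k.+1)) -yS => /le_trans; apply.
have E1 := gamma_le_cbrt k; have E2 := rho_cbrt k.
have E3 : rho k <= Srho / cbrt k.+1.
  rewrite ler_pdivlMr// (le_trans _ E2)// ler_pM2l// expr2 ler_peMl//.
  exact: ltW.
have : (gam k + 2 * rho k) * sigma <= (2 * gamma0 / cbrt k.+1 + 2 * (Srho / cbrt k.+1)) * sigma.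
  by rewrite ler_wpM2r//; lra.
have -> : (2 * gamma0 / cbrt k.+1 + 2 * (Srho / cbrt k.+1)) * sigma =
   ((2 * gamma0 + 2 * Srho) * sigma) / cbrt k.+1 by field; rewrite gt_eqF.
have : ((2 * gamma0 + 2 * Srho) * sigma) / cbrt k.+1 <= D / cbrt k.+1.
  by rewrite ler_pM2r ?invr_gt0// lerDr.
lra.
Qed.

Lemma stationarity_rate : exists2 B, 0 < B & forall eps, 0 < eps ->
  exists2 t, G t < eps & t%:R <= B / eps ^+ 3 + 2.
Proof.
have [D HD] := stationarity_le; have [V V0 HV] := summable_decrease.
have V'0 : 0 <= lmax / gamma0 * V by rewrite mulr_ge0// divr_ge0// ltW.
apply: (@weighted_sum_rate R G (fun k => b k 0%N * enorm (v k 0%N)) D (lmax / gamma0 * V)) => //.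
- by case.
- by move=> k; rewrite mulr_ge0 ?enorm_ge0// ltW// beta_gt0.
move=> K; have [K1|K1] := leqP K 1; first by rewrite big_geq.
apply: (@le_trans _ _ (lmax / gamma0 * \sum_(1 <= k < K) b k 0%N * enorm (v k 0%N) ^+ 2)).
  rewrite mulr_sumr; apply: ler_sum_nat => -[//|k] _.
  have [/andP[_ lk] _ _ _ _] := step (T_gt0 k.+1).
  have bk0 := beta_gt0 (T_gt0 k.+1).
  have s00 := @cbrt_gt0 R k.+1 isT.
  have mu0 : 0 < rho k.+1 + gam k.+1 by rewrite addr_gt0 ?gamma_gt0.
  (* beta is at most lmax / gamma_k, whose cube root cancels; one factor of the squared beta is thus
     traded for a constant. *)
  have bc : b k.+1 0%N / cbrt k.+1 <= lmax / gamma0.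
    rewrite /beta ler_pdivrMr// ler_pdivrMr// (le_trans lk)//.
    rewrite gammaE.
    have -> : lmax / gamma0 * cbrt k.+1 * (rho k.+1 + gamma0 / cbrt k.+1)
      = lmax * (cbrt k.+1 * rho k.+1 / gamma0 + 1) by field; rewrite !gt_eqF.
    rewrite ler_peMr ?(ltW lmax_gt0)// lerDr divr_ge0 ?(ltW gamma0_gt0)//.
    by rewrite mulr_ge0 ?(ltW s00) ?(ltW (rho_gt0 _)).
  have -> : (b k.+1 0%N * enorm (v k.+1 0%N)) ^+ 2 / cbrt k.+1 =
     (b k.+1 0%N / cbrt k.+1) * (b k.+1 0%N * enorm (v k.+1 0%N) ^+ 2).
    by field; rewrite gt_eqF.
  by rewrite ler_wpM2r// mulr_ge0 ?sqr_ge0// ltW.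
rewrite ler_wpM2l//; first by rewrite divr_ge0// ltW.
have := HV K; rewrite (big_cat_nat (n := 1))//= 1?ltnW// big_nat1.
have : 0 <= b 0%N 0%N * enorm (v 0%N 0%N) ^+ 2.
  by rewrite mulr_ge0 ?sqr_ge0// ltW// beta_gt0.
lra.
Qed.

(** * The numerator of C and its degenerate case *)

Let N := Q_upper M S f h g - Q_lower M S f h g gamma0 (rho 0%N) y0
  + gamma0 / 2 * sigma ^+ 2 + 2 * (Tbar.+1)%:R * limn (series rho) * sigma ^+ 2.

Lemma objective_le_Q_upper z w : M z -> S w -> objective f h g z w <= Q_upper M S f h g.
Proof.
move=> Mz Sw; apply: (@ub_le_sup _ [set objective f h g p.1 p.2 | p in M `*` S]).
  have [B _ HB] := objective_bounded; exists B => _ [[z' w'] [Mz' Sw'] <-].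
  by rewrite (le_trans (ler_norm _))// HB.
by exists (z, w).
Qed.

Lemma Q_lower_le_objective z w : M z -> S w ->
  Q_lower M S f h g gamma0 (rho 0%N) y0 <= objective f h g z w.
Proof.
move=> Mz Sw.
have p0 (w' : 'rV[R]_n2) : 0 <= rho 0%N / 2 * enorm (w' - y0) ^+ 2 /\
    0 <= gamma0 / 2 * enorm w' ^+ 2.
  by split; rewrite mulr_ge0 ?sqr_ge0// divr_ge0 ?(ltW (rho_gt0 _)) ?(ltW gamma0_gt0).
apply: (@le_trans _ _ (objective f h g z w - rho 0%N / 2 * enorm (w - y0) ^+ 2
           - gamma0 / 2 * enorm w ^+ 2)); last by have [] := p0 w; lra.
apply: (@ge_inf _ [set objective f h g p.1 p.2 - rho 0%N / 2 * enorm (p.2 - y0) ^+ 2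
           - gamma0 / 2 * enorm p.2 ^+ 2 | p in M `*` S]); last by exists (z, w).
have [B _ HB] := objective_bounded.
exists (- B - rho 0%N / 2 * (4 * sigma ^+ 2) - gamma0 / 2 * sigma ^+ 2).
move=> _ [[z' w'] [/= Mz' Sw'] <-].
have := HB z' w' Mz' Sw'; rewrite ler_norml => /andP[? _].
have g2 : 0 <= gamma0 / 2 by rewrite divr_ge0// ltW.
have r2 : 0 <= rho 0%N / 2 by rewrite divr_ge0// (ltW (rho_gt0 _)).
have := ler_wpM2l g2 (enorm_sqr_le_sigma Sw').
have := ler_wpM2l r2 (enorm_sqrB_le_sigma Sw' Sy0).
lra.
Qed.

Lemma numerator_ge0 : 0 <= N.
Proof.
have := objective_le_Q_upper Mx0 Sy0; have := Q_lower_le_objective Mx0 Sy0.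
have : 0 <= gamma0 / 2 * sigma ^+ 2 by rewrite mulr_ge0 ?sqr_ge0// divr_ge0// ltW.
have : 0 <= 2 * (Tbar.+1)%:R * limn (series rho) * sigma ^+ 2.
  by rewrite !mulr_ge0 ?s_ge0// Srho_ge0.
rewrite /N; lra.
Qed.

(* When the numerator of C vanishes, S is {0} and F(., 0) is constant on M, so
   the starting point is already stationary. *)
Lemma degenerate_stationary : N = 0 -> G 0%N <= 0.
Proof.
move=> N0.
have H1 := objective_le_Q_upper Mx0 Sy0; have H2 := Q_lower_le_objective Mx0 Sy0.
have H3 : 0 <= gamma0 / 2 * sigma ^+ 2 by rewrite mulr_ge0 ?sqr_ge0// divr_ge0// ltW.
have H4 : 0 <= 2 * (Tbar.+1)%:R * limn (series rho) * sigma ^+ 2.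
  by rewrite !mulr_ge0 ?s_ge0// Srho_ge0.
(* N is a sum of nonnegative terms, so each of them vanishes. *)
have sg0 : gamma0 / 2 * sigma ^+ 2 = 0 by move: N0; rewrite /N; lra.
have QQ : Q_upper M S f h g = Q_lower M S f h g gamma0 (rho 0%N) y0.
  by move: N0; rewrite /N; lra.
have s0 : sigma = 0.
  apply/eqP; rewrite -sqrf_eq0; move/eqP: sg0.
  by rewrite mulf_eq0 => /orP[|//]; rewrite gt_eqF// divr_gt0.
have S1 z : S z -> z = 0.
  move=> Sz; apply/rowP => i; rewrite mxE; apply/eqP; rewrite -normr_le0.
  by rewrite (le_trans (coord_le_enorm _ _))// -s0; exact: (enorm_le_sigma PB).
have Sy1 z : S z -> z = y 0%N by move=> /S1 ->; rewrite (S1 _ (y_in 0)).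
rewrite /G /stationarity ge_max; apply/andP; split; last first.
  by apply: (dist0_singleton PB); [exact: y_in|exact: Sy1].
rewrite /argmin; case: xgetP => [u _ Hu|_]; last by rewrite scaler0 enorm0.
have yE z : ybark S f g gamma0 rho y 0%N z = y 0%N.
  by apply: Sy1; have [] := ybarP PB (gam 0%N) (rho 0%N) (y 0%N) z.
have QE z : M z -> Qk 0 z = Q_upper M S f h g.
  move=> Mz; rewrite Q_ybar yE subrr (S1 _ (y_in 0)) enorm0 expr0n/= !mulr0 !subr0.
  apply/eqP; rewrite eq_le objective_le_Q_upper ?QQ ?Q_lower_le_objective//.
  - by rewrite -(S1 _ Sy0).
  - by rewrite -(S1 _ Sy0).
have [kappa kappa0 H] := sufficient_decrease.
have [/andP[lk _] _ _ _ _] := step (T_gt0 0).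
(* A step short enough for a decrease with c = 1/2; since Q_0 is constant on M, this decrease must
   be 0, which forces u = 0. *)
pose a := Num.min 1 (lmin / 2 / kappa).
have a0 : 0 < a by rewrite lt_min ltr01 !divr_gt0.
have a01 : 0 <= a <= 1 by rewrite (ltW a0) ge_min lexx.
have ak : a * kappa <= (1 - 2^-1) * lmin.
  rewrite -ler_pdivlMr// ge_min; apply/orP; right.
  rewrite ler_pM2r ?invr_gt0//; lra.
have half : 2^-1 <= 1 :> R by lra.
have := H _ _ 0%N _ _ _ (x_in 0) a01 ak half lk.
move=> /(_ u); rewrite yE => /(_ Hu).
have [Tu _] := Hu.
have Mr := retraction_in retrM (x_in 0) (tangent_spaceZ a Tu).
rewrite !QE//; last exact: x_in.
have b0 := beta_gt0 (T_gt0 0); rewrite -/(b 0%N 0%N).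
set Qu := Q_upper _ _ _ _ _ => H5.
have : (a * b 0%N 0%N / 2) * enorm u ^+ 2 <= 0.
  by move: H5; rewrite /beta; lra.
rewrite pmulr_rle0; last by rewrite divr_gt0// mulr_gt0.
move=> u0; have /eqP : enorm u ^+ 2 == 0 by rewrite eq_le u0 sqr_ge0.
by move/eqP; rewrite sqrf_eq0 enormZp ?(ltW b0)// => /eqP ->; rewrite mulr0.
Qed.

(** Since ln eta < 0, rounding the logarithm up can only lower the power of eta. *)
Lemma J1_le abar : 0 < abar -> eta ^ J1 c1 eta abar <= abar / (4 * c1).
Proof.
move=> ab0; set z := Num.min 1 abar / (4 * c1).
have z0 : 0 < z by rewrite divr_gt0 ?mulr_gt0// lt_min ltr01.
apply: (@le_trans _ _ z); last first.
  by rewrite ler_pM2r ?invr_gt0 ?mulr_gt0// ge_min lexx orbT.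
have le0 : ln eta < 0 by rewrite ln_lt0// eta_gt0.
have J0 : 0 <= J1 c1 eta abar by rewrite le_max lexx orbT.
have HJ : ln z / ln eta <= (J1 c1 eta abar)%:~R.
  rewrite (le_trans (ceil_ge _))// ler_int le_max lexx //.
case: (J1 c1 eta abar) J0 HJ => // m _ HJ.
rewrite -exprnP -ler_ln ?posrE ?exprn_gt0// lnXn// -[leLHS]mulr_natl.
by rewrite -ler_ndivrMr.
Qed.

(** Stated for all smaller [abar], so that the threshold can be combined with the one required by
    the descent inequality. *)
Lemma complexity_constant_large : 0 < N -> forall B, exists2 ab, 0 < ab &
  forall abar, 0 < abar <= ab ->
    B <= complexity_constant M S f h g c1 eta gamma0 lmax rho Tbar abar y0.
Proof.
move=> N0 B; exists (2 * N * lmax / (gamma0 * (B ^+ 2 + 1))).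
  by rewrite divr_gt0// !mulr_gt0// ltr_wpDl// sqr_ge0.
move=> abar ab; rewrite /complexity_constant -/N.
apply: (sqrt_ratio_ge N0 lmax_gt0 c1_gt0 _ gamma0_gt0 ab); first exact: exprz_gt0.
by apply: J1_le; have /andP[] := ab.
Qed.

End Run.

(** * Choice of the step bound and the complexity estimate *)

Theorem theorem1 (R : realType) (n1 n2 : nat)
    (M : set 'rV[R]_n1) (S : set 'rV[R]_n2)
    (f : 'rV[R]_n1 -> 'rV[R]_n2 -> R)
    (h : 'rV[R]_n1 -> R) (g : 'rV[R]_n2 -> R)
    (Lx Ly Lh : R)
    (retr : 'rV[R]_n1 -> 'rV[R]_n1 -> 'rV[R]_n1)
    (c1 eta gamma0 lmin lmax : R) (rho : nat -> R)
    (Tbar : nat) (T : nat -> nat)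
    (x0 : 'rV[R]_n1) (y0 : 'rV[R]_n2)
    (x : nat -> 'rV[R]_n1) (y : nat -> 'rV[R]_n2)
    (xi : nat -> nat -> 'rV[R]_n1) (l : nat -> nat -> R)
    (v : nat -> nat -> 'rV[R]_n1) (j : nat -> nat -> nat) :
  minimax_problem M S f h g Lx Ly Lh ->
  retraction M retr ->
  mpgda_pa_params c1 eta gamma0 lmin lmax rho Tbar T ->
  mpgda_pa_run M S f h g retr c1 eta gamma0 lmin lmax rho T y x0 y0
    x xi l v j ->
  let b := beta gamma0 rho l in
  let Qk := Qk S f h g gamma0 rho y in
  exists abar : R,
    [/\ 0 < abar,
        forall (k i : nat) (a : R), (i < T k)%N ->
          0 < a -> a <= Num.min 1 abar ->
          Qk k (retr (xi k i) (a *: v k i)) <=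
          Qk k (xi k i) - a / 4 * b k i * enorm (v k i) ^+ 2
          + 2 * rho k * sigma_y S ^+ 2
      & let C := complexity_constant M S f h g c1 eta gamma0 lmax rho Tbar
                   abar y0 in
        forall eps : R, 0 < eps ->
          exists Teps : nat,
            [/\ stationarity M S f h g (b Teps 0%N) (x Teps) (y Teps) < eps,
                forall k, (k < Teps)%N ->
                  ~ stationarity M S f h g (b k 0%N) (x k) (y k) < eps
              & Teps%:R <=
                Num.max ((2 * rho 0%N + gamma0) * sigma_y S) C ^+ 3
                / eps ^+ 3 + 1]].
Proof.
move=> PB retrM params run b Qk.
have [_ [rho0 _ _ _]] := params.
have [[_ _ gamma00 /andP[lmin0 _]] _] := params.
have [kappa kappa0 Hdec] := sufficient_decrease y PB retrM params.
(* c = 1/4 allows a kappa up to (3/4) lmin; half of lmin leaves room. *)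
pose ab1 := lmin / 2 / kappa.
have ab10 : 0 < ab1 by rewrite !divr_gt0.
have descent (abar : R) : abar <= ab1 -> forall (k i : nat) (a : R), (i < T k)%N ->
    0 < a -> a <= Num.min 1 abar ->
    Qk k (retr (xi k i) (a *: v k i)) <=
    Qk k (xi k i) - a / 4 * b k i * enorm (v k i) ^+ 2 + 2 * rho k * sigma_y S ^+ 2.
  move=> able k i a iT a0; rewrite le_min => /andP[a1 aab].
  have [_ _ _ /(_ k i iT)[/andP[lk _] Hv _ _ _] _] := run.
  have a01 : 0 <= a <= 1 by rewrite (ltW a0).
  have ak : a * kappa <= (1 - 4^-1) * lmin.
    have : a * kappa <= lmin / 2 by rewrite -ler_pdivlMr// (le_trans aab).
    lra.
  have Mxi := xi_in retrM run (x_in retrM run k) (ltnW iT).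
  have q1 : 4^-1 <= 1 :> R by lra.
  have := Hdec _ _ k _ _ _ Mxi a01 ak q1 lk Hv.
  have : 0 <= 2 * rho k * sigma_y S ^+ 2 by rewrite !mulr_ge0 ?(ltW (rho0 _)) ?(sigma_ge0 PB).
  rewrite /Qk /b /beta; lra.
have [B B0 HB] := stationarity_rate PB retrM params run.
set G := fun k => stationarity M S f h g (b k 0%N) (x k) (y k).
have N0 := numerator_ge0 PB params run.
set N := Q_upper M S f h g - _ + _ + _ in N0.
have [Nz|Nnz] := eqVneq N 0.
  exists ab1; split=> //; first exact: descent.
  move=> C eps e0; exists 0%N; split=> //.
    by rewrite (le_lt_trans (degenerate_stationary PB retrM params run Nz)).
  rewrite addr_ge0// divr_ge0 ?exprn_ge0 ?(ltW e0)//.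
  by rewrite le_max mulr_ge0 ?(sigma_ge0 PB)// addr_ge0 ?mulr_ge0 ?(ltW (rho0 _)) ?(ltW gamma00).
have Np : 0 < N by rewrite lt_neqAle eq_sym Nnz.
pose g0 := `|G 0%N|.
(* The target 2 g0 + B + 1 is the one required by [cube_ge]. *)
have [ab2 ab20 HC] := complexity_constant_large params Np (2 * g0 + B + 1).
pose abar := Num.min ab1 ab2.
have abar0 : 0 < abar by rewrite lt_min ab10.
exists abar; split=> //; first by apply: descent; rewrite ge_min lexx.
move=> C eps e0.
have [t0 Gt0 t0B] := HB eps e0.
have [t [Gt mint tt0]] := @exists_min_nat (fun k => G k < eps) t0 Gt0.
exists t; split=> //.
have HCabar : 2 * g0 + B + 1 <= Num.max ((2 * rho 0%N + gamma0) * sigma_y S) C.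
  by rewrite le_max HC ?orbT// abar0 ge_min lexx orbT.
move: (Num.max _ _) HCabar => m Hm.
have g00 : 0 <= g0 := normr_ge0 _.
have m1 : 1 <= m by lra.
have e30 : 0 < eps ^+ 3 by rewrite exprn_gt0.
case: t tt0 mint {Gt} => [_ _|t tt0 mint].
  by rewrite addr_ge0// divr_ge0 ?(ltW e30)// exprn_ge0// (le_trans ler01).
(* A positive first hitting index means that index 0 fails, so eps is at most g0; then eps^3 <= g0^3
   turns the additive 2 into 1. *)
have epsg0 : eps <= g0.
  by have /negP := mint 0%N isT; rewrite -leNgt => /le_trans; apply; exact: ler_norm.
have tB : t.+1%:R <= B / eps ^+ 3 + 2 by rewrite (le_trans _ t0B)// ler_nat.
rewrite (le_trans tB)//.
have -> : B / eps ^+ 3 + 2 = (B + eps ^+ 3) / eps ^+ 3 + 1 by field; rewrite gt_eqF.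
rewrite lerD2r ler_pM2r ?invr_gt0//.
have e3 : eps ^+ 3 <= g0 ^+ 3 by rewrite ler_pXn2r ?nnegrE ?(ltW e0).
by rewrite (le_trans _ (cube_ge (ltW B0) g00 Hm))// lerD2l.
Qed.
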